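(* Let $\Omega \subset \mathbb{C}^n$ be a convex domain (not necessarily bounded). Then for every point $a \in \Omega$ and every tangent vector ${\bf v} \in \mathbb{C}^n$ at $a$, the infinitesimal Carathéodory metric equals the infinitesimal Kobayashi metric: $$C_\Omega(a;{\bf v}) = K_\Omega(a;{\bf v}).$$
   Context: $D$ is the open unit disc in $\mathbb{C}$. For a domain $\Omega\subset\mathbb{C}^n$, $a\in\Omega$, ${\bf v}\in\mathbb{C}^n$: The infinitesimal Kobayashi metric is $K_\Omega(a;{\bf v}) = \inf\{1/\lambda : \lambda>0$ and there is a holomorphic $f:D\to\Omega$ with $f(0)=a$ and $f'(0)=\lambda {\bf v}\}$. The infinitesimal Carathéodory metric is $C_\Omega(a;{\bf v}) = \sup\{\rho_D(g(a); dg_a({\bf v})) : g:\Omega\to D \text{ holomorphic}\}$, where $\rho_D(\zeta;\xi)=|\xi|/(1-|\zeta|^2)$ is the infinitesimal Poincaré metric on $D$, normalized so that $\rho_D(0;\xi)=|\xi|$. *)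

(* Defs.v *)
From HB Require Import structures.
From mathcomp Require Import all_boot all_order all_algebra.
From mathcomp Require Import complex.
From mathcomp Require Import all_classical all_reals all_analysis.

Set Implicit Arguments.
Unset Strict Implicit.
Unset Printing Implicit Defensive.

Import Order.TTheory GRing.Theory Num.Theory.
Import numFieldNormedType.Exports.

Local Open Scope classical_set_scope.
Local Open Scope ring_scope.
Local Open Scope complex_scope.

(* [numFieldNormedType] equips the sorts of abstract numeric fields with the
   topology of their norm, but this does not reach the concrete type [R[i]];
   we transport the same structures explicitly. *)
HB.instance Definition _ (R : realType) := Vector.copy R[i] R[i]^o.
HB.instance Definition _ (R : realType) := NormedModule.copy R[i] R[i]^o.

(* The library's [convex_set] over the scalars R[i] takes coefficients t in R[i]
   with 0 <= t <= 1. For the order of R[i] these are the real numbers of [0, 1],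
   so it is the usual convexity of a subset of C^n. *)
Lemma convex_setCP (R : realType) (n : nat) (A : set 'rV[R[i]]_n) :
  convex_set A <-> forall x y (t : R), A x -> A y -> 0 <= t <= 1 ->
    A (t%:C *: x + (1 - t)%:C *: y).
Proof.
split=> [cA x y t Ax Ay /andP[t0 t1]|cA x y t /set_mem Ax /set_mem Ay].
  have t0' : 0 <= t%:C :> R[i] by rewrite ler0c.
  have t1' : t%:C <= 1 :> R[i] by rewrite lecR.
  rewrite rmorphB; apply/set_mem.
  exact: (cA x y (Itv01 t0' t1') (mem_set Ax) (mem_set Ay)).
apply/mem_set; have [t0 t1] : 0 <= t%:num /\ t%:num <= 1 by split; [exact: ge0 | exact: le1].
have tE : t%:num = (complex.Re t%:num)%:C.
  by apply/eqP; rewrite eq_complex /= eqxx /=; move: t0; rewrite lecE => /andP[].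
move: t0 t1; rewrite tE ler0c lecR => t0 t1.
have := cA x y _ Ax Ay (introT andP (conj t0 t1)).
move: tE; move: (complex.Re _) => r tE. rewrite rmorphB /= -tE. exact.
Qed.

Section Metrics.
Context {R : realType}.
Local Notation C := R[i].

(* [differentiable] is Frechet differentiability over the scalar field of the
   normed modules, here C: this is complex differentiability. [f] is total, but
   only its values on [A] matter when [A] is open. *)
Definition holomorphic_on {V W : normedModType C} (A : set V) (f : V -> W) :=
  {in A, forall x, differentiable f x}.

Definition is_domain {T : topologicalType} (A : set T) :=
  [/\ open A, connected A & A !=set0].

Definition unit_disc : set C := [set z | `|z| < 1].

Definition poincare (zeta xi : C) : R :=
  Normc.normc xi / (1 - Normc.normc zeta ^+ 2).

Definition kobayashi {n : nat} (Omega : set 'rV[C]_n) (a v : 'rV[C]_n) :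
    \bar R :=
  ereal_inf [set (1 / lambda)%:E | lambda in [set lambda : R |
    0 < lambda /\
    exists f : C -> 'rV[C]_n,
      [/\ holomorphic_on unit_disc f, f @` unit_disc `<=` Omega,
          f 0 = a & derive1 f 0 = lambda%:C *: v]]].

Definition caratheodory {n : nat} (Omega : set 'rV[C]_n) (a v : 'rV[C]_n) :
    \bar R :=
  ereal_sup [set (poincare (g a) ('d g a v))%:E | g in
    [set g : 'rV[C]_n -> C |
      holomorphic_on Omega g /\ g @` Omega `<=` unit_disc]].

End Metrics.

(* Main.v *)
(* [C <= K] is the Schwarz-Pick lemma for maps that are merely complex
   differentiable.  Goursat's bisection on rectangles gives a Cauchy estimate
   [|H'(0)| <= 4] for [H : D -> D] fixing [0]; applied to the iterates of [H] it
   becomes [|H'(0)|^k <= 4] for all [k], hence [|H'(0)| <= 1].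

   [K <= C] is a convex duality.  If no disc through [a] in direction [v] is
   large, then the moments of the maps from the [N]-th roots of unity to [Omega]
   miss those of such a disc (a Fejer average of the samples would be one), and a
   hyperplane separates them.  The separating functional, smoothed by the same
   Fejer kernel, yields polynomials [U] and [Phi] such that
   [q_z(X) = X U(X) - <z - a, Phi(X)>] satisfies [Re (q_z(X) / X) > 0] on the unit
   circle for every [z] in [Omega].  Then [q_z] has exactly one root [g z] in the
   disc, [g : Omega -> D] is holomorphic, vanishes at [a], and
   [dg_a(v) = <v, Phi(0)> / U(0)] nearly realizes the Kobayashi metric. *)
Require Import Defs.
From HB Require Import structures.
From mathcomp Require Import all_boot all_order all_algebra.
From mathcomp Require Import all_solvable all_field.
From mathcomp Require Import complex.
From mathcomp Require Import all_classical all_reals all_analysis.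
From mathcomp Require Import ring lra.

Set Implicit Arguments.
Unset Strict Implicit.
Unset Printing Implicit Defensive.

Import Order.TTheory GRing.Theory Num.Theory.
Import numFieldNormedType.Exports.

Local Open Scope classical_set_scope.
Local Open Scope ring_scope.
Local Open Scope complex_scope.

(** * Integrals over rectangles and the Goursat lemma *)

Section SegmentIntegral.
Variable R : realType.
Implicit Types (f g : R -> R) (a b c : R).

(** Neither [Omega] nor its family of discs need be compact, so extremal discs and extremal
    functions may fail to exist; each extremal argument is replaced by a finite-dimensional one with
    a small loss. Sampling at [N] roots of unity leaves finitely many points of [Omega], and discs
    are recognized by the vanishing of discrete Fourier coefficients of negative frequency. The set
    of moments need not be closed, so separation requires a positive distance from the target. Since
    the samples vary independently, the separating functional splits into [N] half-spaces containing
    [Omega], and positive Fejer averages of their inequalities give [q_z]; the factor [X] clears the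
    single negative frequency, which comes from the constraint on the derivative. Put
    [K1 = (d - 1) / d], the weight of the first harmonic in the Fejer mean of order [d]. Shrinking
    and averaging the samples cost a factor [K1] each; on the dual side so do the slack [eps] and
    the averaging of the covectors. The total [K1 ^+ 4] tends to 1 as [d] grows. *)

Definition segint f a b : R := \int[lebesgue_measure]_(x in `[a, b]) f x.

Definition seg_continuous f a b := forall x, a <= x <= b -> {for x, continuous f}.

Lemma seg_continuousW f a b c d :
  a <= c -> d <= b -> seg_continuous f a b -> seg_continuous f c d.
Proof.
move=> ac db cf x /andP[cx xd]; apply: cf.
by rewrite (le_trans ac cx) (le_trans xd db).
Qed.

Lemma segint_integrable f a b : seg_continuous f a b ->
  lebesgue_measure.-integrable `[a, b] (EFin \o f).
Proof.
move=> cf; apply: continuous_compact_integrable; first exact: segment_compact.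
apply: continuous_in_subspaceT => x; rewrite inE/= in_itv/= => xab.
exact: cf.
Qed.

Lemma segintD f a b c : seg_continuous f a c -> a <= b <= c ->
  segint f a c = segint f a b + segint f b c.
Proof.
move=> cf /andP[ab bc].
have := @Rintegral_itvB R f (BLeft a) (BRight c) b (segint_integrable cf).
rewrite !bnd_simp => /(_ ab bc) E.
rewrite /segint -(@Rintegral_itv_obnd_cbnd R b (BRight c)); last first.
  apply: integrableS (segint_integrable (seg_continuousW ab (lexx c) cf)) => //.
  by apply: subset_itvr; rewrite bnd_simp.
by rewrite -E; ring.
Qed.

Lemma le_segint f g a b : seg_continuous f a b -> seg_continuous g a b ->
  (forall x, a <= x <= b -> f x <= g x) -> segint f a b <= segint g a b.
Proof.
move=> cf cg fg; apply: le_Rintegral => //; do ?exact: segint_integrable.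
Qed.

Lemma continuous_affine (p q : R) : continuous (fun x : R => p + q * x).
Proof. by move=> x; apply: cvgD; [exact: cvg_cst | apply: cvgM; [exact: cvg_cst|exact: cvg_id]]. Qed.

Lemma segint_affine (p q : R) a b : a <= b ->
  segint (fun x => p + q * x) a b = p * (b - a) + q * (b ^+ 2 - a ^+ 2) / 2.
Proof.
rewrite le_eqVlt => /orP[/eqP ->|ab].
  by rewrite /segint set_itv1 Rintegral_set1; ring.
pose F (x : R) := p * x + q / 2 * x ^+ 2.
have dF x : is_derive x (1:R) F (p + q * x).
  rewrite /F; apply: is_derive_eq; rewrite /= /GRing.scale/=; lra.
rewrite /segint /Rintegral (@continuous_FTC2 R (fun x => p + q * x) F a b ab).
- by rewrite /F/=; lra.
- by apply: continuous_subspaceT => x; exact: continuous_affine.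
- split.
  + by move=> x _; have := dF x; case.
  + apply: cvg_at_right_filter; apply: differentiable_continuous.
    by apply/derivable1_diffP; have := dF a; case.
  + apply: cvg_at_left_filter; apply: differentiable_continuous.
    by apply/derivable1_diffP; have := dF b; case.
- by move=> x _; rewrite derive1E derive_val.
Qed.

Lemma segint_near_affine f a b (p q e : R) : a <= b -> seg_continuous f a b ->
  (forall x, a <= x <= b -> `|f x - (p + q * x)| <= e) ->
  `|segint f a b - (p * (b - a) + q * (b ^+ 2 - a ^+ 2) / 2)| <= e * (b - a).
Proof.
move=> ab cf fe.
have ca p' : seg_continuous (fun x => p' + q * x) a b.
  by move=> x _; exact: continuous_affine.
have H1 : segint f a b <= segint (fun x => (p + e) + q * x) a b.
  apply: le_segint => // x /fe; rewrite ler_norml; lra.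
have H2 : segint (fun x => (p - e) + q * x) a b <= segint f a b.
  apply: le_segint => // x /fe; rewrite ler_norml; lra.
move: H1 H2; rewrite !segint_affine// ler_norml; lra.
Qed.

Lemma segint_ge_cst f a b (m : R) : a <= b -> seg_continuous f a b ->
  (forall x, a <= x <= b -> m <= f x) -> m * (b - a) <= segint f a b.
Proof.
move=> ab cf fm.
have := @le_segint (fun x => m + 0 * x) f a b; rewrite segint_affine//.
rewrite !mul0r addr0; apply => //; first by move=> x _; exact: continuous_affine.
by move=> x /fm; rewrite mul0r addr0.
Qed.

Lemma segint_le_cst f a b (m : R) : a <= b -> seg_continuous f a b ->
  (forall x, a <= x <= b -> f x <= m) -> segint f a b <= m * (b - a).
Proof.
move=> ab cf fm.
have := @le_segint f (fun x => m + 0 * x) a b; rewrite segint_affine//.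
rewrite !mul0r addr0; apply => //; first by move=> x _; exact: continuous_affine.
by move=> x /fm; rewrite mul0r addr0.
Qed.

End SegmentIntegral.

Section Goursat.
Variable R : realType.
Implicit Types (u v : R -> R -> R).

(** Real differentiability of [(u, v)] with a complex-linear Jacobian: [a + i b] is the complex
    derivative. Nothing is asked of the derivative at nearby points, hence Goursat's argument rather
    than Green's formula. *)
Definition cauchy_riemann_at u v (x0 y0 : R) := exists a b : R,
  forall e : R, 0 < e -> exists2 d : R, 0 < d & forall x y,
    `|x - x0| <= d -> `|y - y0| <= d ->
    `|u x y - (u x0 y0 + a * (x - x0) - b * (y - y0))|
      <= e * (`|x - x0| + `|y - y0|) /\
    `|v x y - (v x0 y0 + b * (x - x0) + a * (y - y0))|
      <= e * (`|x - x0| + `|y - y0|).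

Lemma continuous_lipschitz_at (f : R -> R) (x0 d M : R) : 0 < d ->
  (forall x, `|x - x0| <= d -> `|f x - f x0| <= M * `|x - x0|) ->
  {for x0, continuous f}.
Proof.
move=> d0 H; apply/cvgrPdist_le => e e0.
have M0 : 0 < `|M| + 1 by rewrite ltr_wpDl.
apply/nbhs_ballP; exists (Num.min d (e / (`|M| + 1))).
  by rewrite /= lt_min d0 divr_gt0.
move=> x; rewrite /ball/= distrC lt_min => /andP[xd xe].
rewrite distrC (le_trans (H x (ltW xd)))//.
apply: (@le_trans _ _ ((`|M| + 1) * `|x - x0|)).
  by rewrite ler_wpM2r// (le_trans (ler_norm M))// lerDl.
by rewrite -ler_pdivlMl// mulrC ltW.
Qed.

(** The horizontal sides of [rect_loop] integrate only [u] and the vertical ones only [v], so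
    continuity along one axis suffices for each. *)
Lemma cauchy_riemann_continuous u v (x0 y0 : R) : cauchy_riemann_at u v x0 y0 ->
  {for x0, continuous (u ^~ y0)} /\ {for y0, continuous (v x0)}.
Proof.
move=> [a [b H]]; have [d d0 {}H] := H 1 ltr01.
split.
  apply: (@continuous_lipschitz_at _ _ d (`|a| + 1) d0) => x xd.
  have [|+ _] := H x y0 xd; first by rewrite subrr normr0 ltW.
  rewrite subrr mulr0 normr0 addr0 subr0 mul1r mulrDl mul1r -normrM => {}H.
  rewrite (_ : u x y0 - u x0 y0 =
    (u x y0 - (u x0 y0 + a * (x - x0))) + a * (x - x0)); last by ring.
  by rewrite (le_trans (ler_normD _ _))// addrC lerD2l.
apply: (@continuous_lipschitz_at _ _ d (`|a| + 1) d0) => y yd.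
have [|_] := H x0 y _ yd; first by rewrite subrr normr0 ltW.
rewrite subrr mulr0 normr0 add0r addr0 mul1r mulrDl mul1r -normrM => {}H.
rewrite (_ : v x0 y - v x0 y0 =
  (v x0 y - (v x0 y0 + a * (y - y0))) + a * (y - y0)); last by ring.
by rewrite (le_trans (ler_normD _ _))// addrC lerD2l.
Qed.

(* The real part of the contour integral of [(u + iv) dz] along the
   counterclockwise boundary of [[x1, x2] x [y1, y2]]. *)
Definition rect_loop u v (x1 x2 y1 y2 : R) : R :=
  segint (u ^~ y1) x1 x2 - segint (v x2) y1 y2
  - segint (u ^~ y2) x1 x2 + segint (v x1) y1 y2.

Definition cauchy_riemann_on u v (x1 x2 y1 y2 : R) :=
  forall x y, x1 <= x <= x2 -> y1 <= y <= y2 -> cauchy_riemann_at u v x y.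

Lemma cauchy_riemann_segx u v x1 x2 y1 y2 y :
  cauchy_riemann_on u v x1 x2 y1 y2 -> y1 <= y <= y2 ->
  seg_continuous (u ^~ y) x1 x2.
Proof. by move=> H yy x xx; have [] := cauchy_riemann_continuous (H x y xx yy). Qed.

Lemma cauchy_riemann_segy u v x1 x2 y1 y2 x :
  cauchy_riemann_on u v x1 x2 y1 y2 -> x1 <= x <= x2 ->
  seg_continuous (v x) y1 y2.
Proof. by move=> H xx y yy; have [] := cauchy_riemann_continuous (H x y xx yy). Qed.

Lemma rect_loop_split u v x1 x2 x3 y1 y2 y3 :
  x1 <= x2 <= x3 -> y1 <= y2 <= y3 -> cauchy_riemann_on u v x1 x3 y1 y3 ->
  rect_loop u v x1 x3 y1 y3 =
  rect_loop u v x1 x2 y1 y2 + rect_loop u v x2 x3 y1 y2 +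
  (rect_loop u v x1 x2 y2 y3 + rect_loop u v x2 x3 y2 y3).
Proof.
move=> /andP[x12 x23] /andP[y12 y23] H; rewrite /rect_loop.
have x13 := le_trans x12 x23; have y13 := le_trans y12 y23.
rewrite (segintD (b := x2) (cauchy_riemann_segx (y := y1) H _)) ?x12 ?lexx//.
rewrite (segintD (b := x2) (cauchy_riemann_segx (y := y3) H _)) ?x12 ?lexx ?y13//.
rewrite (segintD (b := y2) (cauchy_riemann_segy (x := x1) H _)) ?y12 ?lexx//.
rewrite (segintD (b := y2) (cauchy_riemann_segy (x := x3) H _)) ?y12 ?lexx ?x13//.
ring.
Qed.

Lemma cauchy_riemann_onW u v x1 x2 y1 y2 x1' x2' y1' y2' :
  x1 <= x1' -> x2' <= x2 -> y1 <= y1' -> y2' <= y2 ->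
  cauchy_riemann_on u v x1 x2 y1 y2 -> cauchy_riemann_on u v x1' x2' y1' y2'.
Proof.
move=> a1 a2 b1 b2 H x y /andP[? ?] /andP[? ?]; apply: H.
  by rewrite (le_trans a1)// (le_trans _ a2).
by rewrite (le_trans b1)// (le_trans _ b2).
Qed.

(** The affine part has loop integral zero: its [a] terms cancel between opposite sides, its [b]
    terms between the horizontal and the vertical pair. What remains is the error times the
    perimeter. *)
Lemma rect_loop_small u v x0 y0 (e x1 x2 y1 y2 : R) a b :
  x1 <= x2 -> y1 <= y2 -> cauchy_riemann_on u v x1 x2 y1 y2 ->
  (forall x y, x1 <= x <= x2 -> y1 <= y <= y2 ->
    `|u x y - (u x0 y0 + a * (x - x0) - b * (y - y0))| <= e /\
    `|v x y - (v x0 y0 + b * (x - x0) + a * (y - y0))| <= e) ->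
  `|rect_loop u v x1 x2 y1 y2| <= e * (2 * (x2 - x1) + 2 * (y2 - y1)).
Proof.
move=> x12 y12 H E.
have yy1 : y1 <= y1 <= y2 by rewrite lexx.
have yy2 : y1 <= y2 <= y2 by rewrite lexx andbT.
have xx1 : x1 <= x1 <= x2 by rewrite lexx.
have xx2 : x1 <= x2 <= x2 by rewrite lexx andbT.
have U y : y1 <= y <= y2 ->
    `|segint (u ^~ y) x1 x2 - ((u x0 y0 - a * x0 - b * (y - y0)) * (x2 - x1)
      + a * (x2 ^+ 2 - x1 ^+ 2) / 2)| <= e * (x2 - x1).
  move=> yy; apply: segint_near_affine => //; first exact: cauchy_riemann_segx H yy.
  move=> x xx; have [+ _] := E x y xx yy; congr (`|_| <= _); ring.
have V x : x1 <= x <= x2 ->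
    `|segint (v x) y1 y2 - ((v x0 y0 - a * y0 + b * (x - x0)) * (y2 - y1)
      + a * (y2 ^+ 2 - y1 ^+ 2) / 2)| <= e * (y2 - y1).
  move=> xx; apply: segint_near_affine => //; first exact: cauchy_riemann_segy H xx.
  move=> y yy; have [_] := E x y xx yy; congr (`|_| <= _); ring.
have := U _ yy1; have := U _ yy2; have := V _ xx1; have := V _ xx2.
rewrite /rect_loop !ler_norml.
move: (segint _ _ _) => s1; move: (segint _ _ _) => s2.
move: (segint _ _ _) => s3; move: (segint _ _ _) => s4.
have : b * (y2 - y1) * (x2 - x1) - b * (x2 - x1) * (y2 - y1) = 0 by ring.
lra.
Qed.

(** Some quarter always carries at least a quarter of the loop, and iterating closes in on a point.
    There the error of the affine approximation and the perimeter both scale like [1 / 2 ^+ n], so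
    the loop is an arbitrarily small multiple of [1 / 4 ^+ n], against the lower bound
    [I / 4 ^+ n]. *)
Theorem goursat_rect u v x1 x2 y1 y2 : x1 <= x2 -> y1 <= y2 ->
  cauchy_riemann_on u v x1 x2 y1 y2 -> rect_loop u v x1 x2 y1 y2 = 0.
Proof.
move=> x12 y12 H.
apply/eqP/negPn/negP => loop_neq0.
pose w := x2 - x1; pose h := y2 - y1.
have w0 : 0 <= w by rewrite subr_ge0.
have h0 : 0 <= h by rewrite subr_ge0.
pose I := `|rect_loop u v x1 x2 y1 y2|.
have I0 : 0 < I by rewrite normr_gt0.
(* A state is a generation [n] and a lower left corner; [n] determines the sides. *)
pose Bad (p : nat * (R * R)) := let: (n, (x, y)) := p in
  [/\ x1 <= x, x + w / 2 ^+ n <= x2, y1 <= y, y + h / 2 ^+ n <= y2 &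
   I / 4 ^+ n <= `|rect_loop u v x (x + w / 2 ^+ n) y (y + h / 2 ^+ n)|].
have step (p : {p | Bad p}) : {q : {p | Bad p} |
    [/\ (sval q).1 = (sval p).1.+1,
        (sval p).2.1 <= (sval q).2.1 /\
        (sval q).2.1 + w / 2 ^+ (sval p).1.+1 <= (sval p).2.1 + w / 2 ^+ (sval p).1 &
        (sval p).2.2 <= (sval q).2.2 /\
        (sval q).2.2 + h / 2 ^+ (sval p).1.+1 <= (sval p).2.2 + h / 2 ^+ (sval p).1]}.
  apply: cid; case: p => -[n [x y]] /= B; case: (B) => bx1 bx2 by1 by2 bI.
  pose w' := w / 2 ^+ n.+1; pose h' := h / 2 ^+ n.+1.
  have w'0 : 0 <= w' by rewrite divr_ge0// exprn_ge0.
  have h'0 : 0 <= h' by rewrite divr_ge0// exprn_ge0.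
  have pn : (2 : R) ^+ n != 0 by rewrite expf_neq0.
  have wE : w / 2 ^+ n = w' + w' by rewrite /w' exprS; field.
  have hE : h / 2 ^+ n = h' + h' by rewrite /h' exprS; field.
  have IE : I / 4 ^+ n = 4 * (I / 4 ^+ n.+1).
    by rewrite exprS; field; rewrite expf_neq0.
  rewrite wE in bx2 bI *; rewrite hE in by2 bI *; rewrite IE in bI.
  have Hs : cauchy_riemann_on u v x (x + (w' + w')) y (y + (h' + h')).
    exact: cauchy_riemann_onW H.
  move: bI; rewrite (@rect_loop_split u v x (x + w') _ y (y + h'))//; try lra.
  have good x' y' : x <= x' <= x + w' -> y <= y' <= y + h' ->
      I / 4 ^+ n.+1 <= `|rect_loop u v x' (x' + w') y' (y' + h')| ->
      exists q : {p | Bad p}, [/\ (sval q).1 = n.+1,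
        x <= (sval q).2.1 /\ (sval q).2.1 + w' <= x + (w' + w') &
        y <= (sval q).2.2 /\ (sval q).2.2 + h' <= y + (h' + h')].
    move=> xx yy HI.
    have B' : Bad (n.+1, (x', y')).
      by split=> //; rewrite -/w' -/h'; lra.
    by exists (exist _ _ B'); split=> /=; [|split; lra|split; lra].
  set l1 := rect_loop _ _ _ _ _ _; set l2 := rect_loop _ _ _ _ _ _.
  set l3 := rect_loop _ _ _ _ _ _; set l4 := rect_loop _ _ _ _ _ _ => HI.
  have [g1|g1] := leP (I / 4 ^+ n.+1) `|l1|; first by apply: (good x y) => //; lra.
  have [g2|g2] := leP (I / 4 ^+ n.+1) `|l2|.
    by apply: (good (x + w') y) => //; rewrite -?addrA//; lra.
  have [g3|g3] := leP (I / 4 ^+ n.+1) `|l3|.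
    by apply: (good x (y + h')) => //; rewrite -?addrA//; lra.
  have [g4|g4] := leP (I / 4 ^+ n.+1) `|l4|.
    by apply: (good (x + w') (y + h')) => //; rewrite -?addrA//; lra.
  exfalso; have := ler_normD (l1 + l2) (l3 + l4).
  have := ler_normD l1 l2; have := ler_normD l3 l4; lra.
have B0 : Bad (0%N, (x1, y1)).
  by rewrite /Bad !expr0 !divr1 /w /h !subrKC; split.
pose s n := iter n (fun p => sval (step p)) (exist _ _ B0).
have s1 n : (sval (s n)).1 = n.
  by elim: n => //= n IH; have [-> _ _] := svalP (step (s n)); rewrite IH.
pose X n := (sval (s n)).2.1; pose Y n := (sval (s n)).2.2.
have Xmon : {homo X : m n / (m <= n)%N >-> m <= n}.
  apply: homo_leq => [//|? ? ?|n]; first exact: le_trans.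
  by have [_ [+ _] _] := svalP (step (s n)).
have Ymon : {homo Y : m n / (m <= n)%N >-> m <= n}.
  apply: homo_leq => [//|? ? ?|n]; first exact: le_trans.
  by have [_ _ [+ _]] := svalP (step (s n)).
have BadX n : [/\ x1 <= X n, X n + w / 2 ^+ n <= x2, y1 <= Y n,
    Y n + h / 2 ^+ n <= y2 &
    I / 4 ^+ n <= `|rect_loop u v (X n) (X n + w / 2 ^+ n) (Y n) (Y n + h / 2 ^+ n)|].
  rewrite /X /Y; move: (svalP (s n)) (s1 n).
  by case: (sval (s n)) => m [x y] /= + mn; rewrite mn.
have step_ge0 (c : R) n : 0 <= c -> 0 <= c / 2 ^+ n.
  by move=> c0; rewrite divr_ge0// exprn_ge0.
(* Nested intervals: left ends increase, right ends decrease, and the supremum of the left ends lies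
   in all of them. *)
have cofinal (Z : nat -> R) (c z2 : R) : 0 <= c ->
    {homo Z : m n / (m <= n)%N >-> m <= n} ->
    (forall n, Z n + c / 2 ^+ n <= z2) ->
    (forall n, Z n.+1 + c / 2 ^+ n.+1 <= Z n + c / 2 ^+ n) ->
    exists z, forall n, Z n <= z <= Z n + c / 2 ^+ n.
  move=> c0 Zm Zb Zd.
  have Zd' : {homo (fun n => - (Z n + c / 2 ^+ n)) : m n / (m <= n)%N >-> m <= n}.
    apply: homo_leq => [//|? ? ?|n]; first exact: le_trans.
    by rewrite lerN2.
  have Zc m n : Z m <= Z n + c / 2 ^+ n.
    have [mn|/ltnW nm] := leqP m n.
      by rewrite (le_trans (Zm _ _ mn))// lerDl step_ge0.
    have := Zd' _ _ nm; rewrite lerN2; apply: le_trans.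
    by rewrite lerDl step_ge0.
  exists (sup (range Z)) => n; apply/andP; split.
    apply: ub_le_sup; last by exists n.
    by exists (Z 0%N + c / 2 ^+ 0) => _ [m _ <-].
  by apply: ge_sup => [|_ [m _ <-]//]; exists (Z 0%N); exists 0%N.
have [x0 Xx0] : exists z, forall n, X n <= z <= X n + w / 2 ^+ n.
  apply: (@cofinal X w x2) => // n; first by case: (BadX n).
  by have [_ [_ +] _] := svalP (step (s n)); rewrite -[sval (step _)]/(s n.+1) s1.
have [y0 Yy0] : exists z, forall n, Y n <= z <= Y n + h / 2 ^+ n.
  apply: (@cofinal Y h y2) => // n; first by case: (BadX n).
  by have [_ _ [_ +]] := svalP (step (s n)); rewrite -[sval (step _)]/(s n.+1) s1.
have [a [b Hab]] : cauchy_riemann_at u v x0 y0.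
  apply: H.
    have := Xx0 0%N; have [] := BadX 0%N; rewrite expr0; lra.
  have := Yy0 0%N; have [] := BadX 0%N; rewrite expr0; lra.
(* With accuracy [e], the error is at most [e (w + h) / 2 ^+ n] and the perimeter is
   [2 (w + h) / 2 ^+ n], so the loop is at most [e S / 4 ^+ n]. Taking [e = I / (S + 1)] beats
   [I / 4 ^+ n], even when [S] is 0. *)
pose S := 2 * (w + h) ^+ 2.
have S0 : 0 <= S by rewrite mulr_ge0// sqr_ge0.
have S1 : 0 < S + 1 by rewrite ltr_wpDl.
have [|d d0 {}Hab] := Hab (I / (S + 1)); first by rewrite divr_gt0.
pose n := Num.bound ((w + h) / d).
have nd : (w + h) / 2 ^+ n <= d.
  rewrite ler_pdivrMr ?exprn_gt0// -ler_pdivrMl// mulrC ltW//.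
  have wd : 0 <= (w + h) / d by apply: divr_ge0; [exact: addr_ge0|exact: ltW].
  apply: (lt_le_trans (archi_boundP wd)).
  by rewrite -natrX ler_nat ltnW// ltn_expl.
have [bx1 bx2 by1 by2 bI] := BadX n.
have wn0 := step_ge0 _ n w0; have hn0 := step_ge0 _ n h0.
have := Xx0 n; have := Yy0 n => yn xn.
move: nd; rewrite mulrDl => nd.
have Hn : cauchy_riemann_on u v (X n) (X n + w / 2 ^+ n) (Y n) (Y n + h / 2 ^+ n).
  exact: cauchy_riemann_onW H.
have := @rect_loop_small u v x0 y0 (I / (S + 1) * (w / 2 ^+ n + h / 2 ^+ n))
   (X n) (X n + w / 2 ^+ n) (Y n) (Y n + h / 2 ^+ n) a b.
rewrite !lerDl => /(_ wn0 hn0 Hn) L.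
suff : ~ (I / 4 ^+ n <=
    `|rect_loop u v (X n) (X n + w / 2 ^+ n) (Y n) (Y n + h / 2 ^+ n)|) by [].
apply/negP; rewrite -ltNge; apply: le_lt_trans (L _) _.
  move=> x y xx yy.
  have xd : `|x - x0| <= w / 2 ^+ n by rewrite ler_norml; lra.
  have yd : `|y - y0| <= h / 2 ^+ n by rewrite ler_norml; lra.
  have [||Hu Hv] := Hab x y; [lra|lra|].
  have le1 : I / (S + 1) * (`|x - x0| + `|y - y0|) <=
      I / (S + 1) * (w / 2 ^+ n + h / 2 ^+ n).
    by rewrite ler_wpM2l ?lerD// divr_ge0// ltW.
  by split; [apply: le_trans Hu _ | apply: le_trans Hv _].
have p2 : (2 : R) ^+ n != 0 by rewrite expf_neq0.
have -> : (4 : R) ^+ n = 2 ^+ n * 2 ^+ n.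
  by rewrite -exprMn; congr (_ ^+ _); lra.
have -> : I / (S + 1) * (w / 2 ^+ n + h / 2 ^+ n) *
   (2 * (X n + w / 2 ^+ n - X n) + 2 * (Y n + h / 2 ^+ n - Y n)) =
   I * (S / (S + 1)) / (2 ^+ n * 2 ^+ n).
  by rewrite /S; field; rewrite p2 gt_eqF.
rewrite ltr_pM2r ?invr_gt0 ?mulr_gt0 ?exprn_gt0//.
by rewrite gtr_pMr// ltr_pdivrMr// mul1r ltrDl.
Qed.
End Goursat.

(** * Complex derivatives *)

Section ComplexNorm.
Variable R : realType.
Local Notation C := R[i].
Local Notation normc := (@Normc.normc R).
Implicit Types z w : C.

Lemma normrc z : `|z| = (normc z)%:C.
Proof. by case: z. Qed.

Lemma normc_ge0 z : 0 <= normc z.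
Proof. by case: z => x y; exact: sqrtr_ge0. Qed.

Lemma normc_gt0 z : (0 < normc z) = (z != 0).
Proof. by rewrite -ltcR -normrc normr_gt0. Qed.

Lemma normcD z w : normc (z + w) <= normc z + normc w.
Proof. by rewrite -lecR rmorphD/= -!normrc ler_normD. Qed.

Lemma normcB z w : normc (z - w) = normc (w - z).
Proof. by apply: complexI; rewrite -!normrc distrC. Qed.

Lemma normc_real (x : R) : normc x%:C = `|x|.
Proof. by rewrite /= expr0n/= addr0 sqrtr_sqr. Qed.

Lemma normcX z n : normc (z ^+ n) = normc z ^+ n.
Proof. by apply: complexI; rewrite rmorphXn/= -!normrc normrX. Qed.

Lemma Re_le_normc z : `|complex.Re z| <= normc z.
Proof. by rewrite -lecR -normrc; exact: normc_ge_Re. Qed.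

Lemma Im_le_normc z : `|complex.Im z| <= normc z.
Proof.
case: z => x y /=; rewrite -sqrtr_sqr ler_wsqrtr//.
by rewrite lerDr sqr_ge0.
Qed.

Lemma normc_le_ReIm z : normc z <= `|complex.Re z| + `|complex.Im z|.
Proof.
case: z => x y /=; rewrite -[X in _ <= X]ger0_norm ?addr_ge0// -sqrtr_sqr.
rewrite ler_wsqrtr// sqrrD !real_normK ?num_real//.
rewrite lerD2r lerDl mulrn_wge0// mulr_ge0//.
Qed.

Lemma normc_sqr z : normc z ^+ 2 = complex.Re z ^+ 2 + complex.Im z ^+ 2.
Proof. by case: z => x y /=; rewrite sqr_sqrtr// addr_ge0 ?sqr_ge0. Qed.

End ComplexNorm.

Section FrechetApprox.
Variables (K : numFieldType) (V W : normedModType K).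
Implicit Types (f : V -> W) (x : V).

Lemma differentiable_near f x : differentiable f x -> forall e : K, 0 < e ->
  \forall h \near (0 : V), `|f (h + x) - (f x + 'd f x h)| <= e * `|h|.
Proof.
move=> /diff_locallyP[_ /eqaddoP H] e e0; exact: H.
Qed.

Lemma near_differentiable f x (df : {linear V -> W}) : continuous df ->
  (forall e : K, 0 < e ->
    \forall h \near (0 : V), `|f (h + x) - (f x + df h)| <= e * `|h|) ->
  differentiable f x /\ 'd f x = df :> (V -> W).
Proof.
move=> cdf H.
have E : f \o shift x = cst (f x) + df +o_ (0 : V) id by apply/eqaddoP => e; exact: H.
have dE := diff_unique cdf E.
by split=> //; apply/diff_locallyP; rewrite dE.
Qed.

End FrechetApprox.

Section ComplexDerivative.
Variable R : realType.
Local Notation C := R[i].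
Local Notation normc := (@Normc.normc R).

Lemma complex_diffE (W : normedModType C) (f : C -> W) (z h : C) :
  'd f z h = h *: 'd f z 1.
Proof. by rewrite -linearZ; congr ('d f z _); exact/esym/mulr1. Qed.

Lemma complex_differentiable_near (f : C -> C) (z : C) : differentiable f z ->
  forall e : R, 0 < e -> exists2 d : R, 0 < d & forall w, normc (w - z) < d ->
    normc (f w - (f z + (w - z) * 'd f z 1)) <= e * normc (w - z).
Proof.
move=> df e e0.
have e0' : (0 : C) < e%:C by rewrite ltcR.
have /nbhs_ballP[d d0 H] := differentiable_near df e0'.
have dE : d = (complex.Re d)%:C by rewrite RRe_real// gtr0_real.
exists (complex.Re d); first by rewrite -ltcR -dE.
move=> w wd.
have := H (w - z); rewrite -ball_normE/= sub0r normrN normrc dE ltcR => /(_ wd).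
by rewrite subrK complex_diffE !normrc -rmorphM/= lecR.
Qed.

Lemma differentiable_cauchy_riemann (f : C -> C) (x y : R) :
  differentiable f (x +i* y) ->
  cauchy_riemann_at (fun x y => complex.Re (f (x +i* y)))
    (fun x y => complex.Im (f (x +i* y))) x y.
Proof.
move=> df; set c := 'd f (x +i* y) 1.
exists (complex.Re c), (complex.Im c) => e e0.
have [d d0 H] := complex_differentiable_near df e0.
exists (d / 3); first by rewrite divr_gt0.
move=> x' y' xd yd.
have ReE : `|x' - x| + `|y' - y| =
   `|complex.Re (x' +i* y' - x +i* y)| + `|complex.Im (x' +i* y' - x +i* y)| by [].
have le1 := normc_le_ReIm (x' +i* y' - x +i* y).
rewrite -ReE in le1.
have /H {}H : normc (x' +i* y' - x +i* y) < d by lra.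
have e1 : e * normc (x' +i* y' - x +i* y) <= e * (`|x' - x| + `|y' - y|).
  by rewrite ler_wpM2l// ltW.
rewrite -/c in H.
split; apply: le_trans e1; apply: le_trans H.
  apply: le_trans (Re_le_normc _); rewrite le_eqVlt; apply/orP; left; apply/eqP.
  congr `|_|; case: (f (x +i* y)) => a b; case: (f (x' +i* y')) => a' b'.
  case: c => c1 c2 /=; ring.
apply: le_trans (Im_le_normc _); rewrite le_eqVlt; apply/orP; left; apply/eqP.
congr `|_|; case: (f (x +i* y)) => a b; case: (f (x' +i* y')) => a' b'.
case: c => c1 c2 /=; ring.
Qed.

End ComplexDerivative.

(** * The Schwarz-Pick lemma *)

Section Annulus.
Variable R : realType.

(** The frame between the two squares is cut into full-height left and right strips and the top and
    bottom pieces over [[-r, r]]. Goursat applies to each, and their loops add up to the difference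
    of the two sides; the inside of the small square may hold a singularity. *)
Lemma rect_loop_annulus (u v : R -> R -> R) (r q : R) : 0 <= r -> r <= q ->
  (forall x y, `|x| <= q -> `|y| <= q -> r <= `|x| \/ r <= `|y| ->
    cauchy_riemann_at u v x y) ->
  rect_loop u v (- q) q (- q) q = rect_loop u v (- r) r (- r) r.
Proof.
move=> r0 rq H.
have CR x1 x2 y1 y2 : - q <= x1 -> x2 <= q -> - q <= y1 -> y2 <= q ->
    (forall x y, x1 <= x <= x2 -> y1 <= y <= y2 -> r <= `|x| \/ r <= `|y|) ->
    cauchy_riemann_on u v x1 x2 y1 y2.
  move=> ? ? ? ? H' x y xx yy; apply: H; last exact: H'.
    by rewrite ler_norml; lra.
  by rewrite ler_norml; lra.
have xl x : x <= - r -> r <= `|x| by move=> ?; rewrite ler0_norm; lra.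
have xr x : r <= x -> r <= `|x| by move=> ?; rewrite ger0_norm; lra.
have L : cauchy_riemann_on u v (- q) (- r) (- q) q.
  by apply: CR; [lra..|move=> x y xx _; left; apply: xl; lra].
have Rr : cauchy_riemann_on u v r q (- q) q.
  by apply: CR; [lra..|move=> x y xx _; left; apply: xr; lra].
have T : cauchy_riemann_on u v (- q) q r q.
  by apply: CR; [lra..|move=> x y _ yy; right; apply: xr; lra].
have B : cauchy_riemann_on u v (- q) q (- q) (- r).
  by apply: CR; [lra..|move=> x y _ yy; right; apply: xl; lra].
have h1 : - q <= - r by lra.
have h2 : - r <= r by lra.
have qq : - q <= q by lra.
have h3 : - q <= r by lra.
have h4 : - r <= q by lra.
have l1 := goursat_rect h1 qq L.
have l2 := goursat_rect rq qq Rr.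
have l3 := goursat_rect h2 rq (cauchy_riemann_onW h1 rq (lexx r) (lexx q) T).
have l4 := goursat_rect h2 h1 (cauchy_riemann_onW h1 rq (lexx (- q)) (lexx (- r)) B).
have cutl : - q <= - r <= q by rewrite h1 h4.
have cutr : - r <= r <= q by rewrite h2 rq.
have cut3 (f : R -> R) : seg_continuous f (- q) q ->
    segint f (- q) q = segint f (- q) (- r) + (segint f (- r) r + segint f r q).
  move=> cf; rewrite (segintD cf cutl) (segintD _ cutr)//.
  exact: seg_continuousW h1 (lexx q) cf.
have S1 := cut3 _ (cauchy_riemann_segx (y := - q) B (introT andP (conj (lexx _) h1))).
have S2 := cut3 _ (cauchy_riemann_segx (y := q) T (introT andP (conj rq (lexx _)))).
have S3 := cut3 _ (cauchy_riemann_segy (x := - r) L (introT andP (conj h1 (lexx _)))).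
have S4 := cut3 _ (cauchy_riemann_segy (x := r) Rr (introT andP (conj (lexx _) rq))).
have lin (a1 a2 b1 b2 b3 b4 : R) :
    b1 = 0 -> b2 = 0 -> b3 = 0 -> b4 = 0 -> a1 - a2 = b1 + b2 + b3 + b4 -> a1 = a2.
  by move=> -> -> -> -> /eqP; rewrite !addr0 subr_eq0 => /eqP.
apply: (lin _ _ _ _ _ _ l1 l2 l3 l4).
rewrite /rect_loop S1 S2 S3 S4; ring.
Qed.

End Annulus.

Section SchwarzPick.
Variable R : realType.
Local Notation C := R[i].
Local Notation normc := (@Normc.normc R).

Lemma differentiable_inv (z : C) : z != 0 -> differentiable (fun w : C => w^-1) z.
Proof. by move=> z0; apply: (@differentiableV C C (fun w => w)). Qed.

(** With [k] unimodular and [k c = |c|], the function [G = k H / z ^+ 2] behaves like [|c| / z] at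
    0. Two crude bounds replace the exact value [2 pi |c|] of the loop: on a tiny square each side
    contributes at least [|c| - 2 e], while on the square of half-side 1/2, whose perimeter is 4,
    [|G| <= 4]. Hence [4 |c| <= 16]. *)
Lemma cauchy_weak (H : C -> C) : holomorphic_on unit_disc H ->
  (forall z, unit_disc z -> normc (H z) <= 1) -> H 0 = 0 ->
  normc ('d H 0 1) <= 4.
Proof.
move=> dH H1 H0; set c := 'd H 0 1.
have [->|c0] := eqVneq c 0; first by rewrite Normc.normc0.
have nc0 : 0 < normc c by rewrite normc_gt0.
pose k : C := (normc c)%:C / c.
have kc : k * c = (normc c)%:C by rewrite /k divfK.
have k1 : normc k = 1.
  rewrite Normc.normcM Normc.normcV normc_real ger0_norm ?normc_ge0//.
  by rewrite divff// gt_eqF.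
pose G z := k * (H z / z ^+ 2).
(* The factor [- 'i] turns the real part of [F dz], which [rect_loop] computes, into the imaginary
   part of [G dz]. *)
pose F z := - 'i * G z.
have discE z : unit_disc z <-> normc z < 1 by rewrite /unit_disc/= normrc ltcR.
have dF z : unit_disc z -> z != 0 -> differentiable F z.
  move=> zD z0; have -> : F = cst (- 'i * k) * (H * ((fun w => w^-1) * (fun w => w^-1))).
    by apply/funext => w; rewrite /F /G !fctE/= expr2 invfM !mulrA.
  apply: differentiableM; first exact: differentiable_cst.
  apply: differentiableM; first by apply: dH; rewrite inE.
  by apply: differentiableM; apply: differentiable_inv.
pose u x y := complex.Re (F (x +i* y)); pose v x y := complex.Im (F (x +i* y)).
have uE x y : u x y = complex.Im (G (x +i* y)).
  by rewrite /u /F; case: (G _) => a b /=; ring.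
have vE x y : v x y = - complex.Re (G (x +i* y)).
  by rewrite /v /F; case: (G _) => a b /=; ring.
pose q : R := 2^-1.
have CR (r : R) x y : 0 < r -> `|x| <= q -> `|y| <= q -> r <= `|x| \/ r <= `|y| ->
    cauchy_riemann_at u v x y.
  move=> r0 xq yq xy; apply: differentiable_cauchy_riemann; apply: dF.
    apply/discE; rewrite -(@ltr_pXn2r _ 2) ?nnegrE ?normc_ge0// normc_sqr/= expr1n.
    by move: xq yq; rewrite /q !ler_norml => ? ?; nra.
  apply/eqP => -[x0 y0]; move: xy; rewrite x0 y0 normr0; lra.
have loop_ge (e : R) : 0 < e -> 4 * (normc c - 2 * e) <= rect_loop u v (- q) q (- q) q.
  move=> e0.
  have [|d d0 Hd] := @complex_differentiable_near R H 0 _ _ e0.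
    by apply: dH; rewrite inE; apply/discE; rewrite Normc.normc0.
  (* On the square of half-side [r], [|z| <= |x| + |y| <= 2 r < d]. *)
  pose r := Num.min (d / 3) q.
  have r0 : 0 < r by rewrite lt_min divr_gt0//= invr_gt0.
  have rq : r <= q by rewrite ge_min lexx orbT.
  have rd : r <= d / 3 by rewrite ge_min lexx.
  rewrite (rect_loop_annulus (ltW r0) rq); last by move=> x y; exact: CR.
  have near x y : `|x| <= r -> `|y| <= r -> r <= `|x| \/ r <= `|y| ->
      normc (G (x +i* y) - (normc c)%:C / (x +i* y)) <= e / r.
    move=> xr yr xy; set z := x +i* y.
    have z0 : z != 0 by apply/eqP => -[x0 y0]; move: xy; rewrite x0 y0 normr0; lra.
    have rz : r <= normc z.
      by case: xy => ?; [have := Re_le_normc z|have := Im_le_normc z]; rewrite /=; lra.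
    have zd : normc (z - 0) < d.
      rewrite subr0; apply: le_lt_trans (normc_le_ReIm _) _; rewrite /=; lra.
    have := Hd _ zd; rewrite H0 add0r subr0 -/c => Hz.
    have -> : G z - (normc c)%:C / z = k * ((H z - z * c) / z ^+ 2).
      by rewrite /G -kc; field.
    rewrite Normc.normcM k1 mul1r Normc.normcM Normc.normcV normcX.
    have nz : 0 < normc z by lra.
    rewrite ler_pdivrMr ?exprn_gt0// (le_trans Hz)// expr2 mulrA.
    apply: ler_wpM2r; first exact: ltW.
    by rewrite mulrAC ler_pdivlMr// ler_wpM2l// ltW.
  have invE : forall x y : R, (normc c)%:C / (x +i* y) =
      (normc c * x / (x ^+ 2 + y ^+ 2)) +i* (- (normc c * y / (x ^+ 2 + y ^+ 2))).
    move=> x y; apply/eqP; rewrite eq_complex /=; apply/andP.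
    by split; apply/eqP; rewrite /=; ring.
  (* On each side the relevant component of [|c| / z] is, up to sign, [|c| r / (r ^+ 2 + t ^+ 2)],
     at least half its value at the midpoint [t = 0]. *)
  have frac t : `|t| <= r -> normc c / (2 * r) <= normc c * r / (r ^+ 2 + t ^+ 2).
    move=> tr; have ht : t ^+ 2 <= r ^+ 2.
      by rewrite -[t ^+ 2]real_normK ?num_real// ler_sqr ?nnegrE// ltW.
    have h : 0 < r ^+ 2 + t ^+ 2 by rewrite ltr_pwDl ?sqr_ge0// exprn_gt0.
    rewrite ler_pdivlMr// mulrAC ler_pdivrMr ?mulr_gt0// -mulrA.
    by rewrite ler_wpM2l ?normc_ge0//; nra.
  have rr : - r <= r by lra.
  have uy y : `|y| = r -> seg_continuous (u ^~ y) (- r) r.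
    move=> yr x xx; have xr : `|x| <= r by rewrite ler_norml.
    by have [] := cauchy_riemann_continuous (CR r x y r0 _ _ _);
      rewrite ?yr//; [lra|right].
  have vx x : `|x| = r -> seg_continuous (v x) (- r) r.
    move=> xr y yy; have yr : `|y| <= r by rewrite ler_norml.
    by have [] := cauchy_riemann_continuous (CR r x y r0 _ _ _);
      rewrite ?xr//; [lra|left].
  have nr : `|r| = r by rewrite gtr0_norm.
  have nNr : `|- r| = r by rewrite normrN.
  pose m := normc c / (2 * r) - e / r.
  have mE : m * (r - - r) = normc c - 2 * e by rewrite /m; field; rewrite gt_eqF.
  have I1 : m * (r - - r) <= segint (u ^~ (- r)) (- r) r.
    apply: (segint_ge_cst rr) => [|x xx]; first exact: uy.
    have xr : `|x| <= r by rewrite ler_norml.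
    have := near x (- r) xr; rewrite nNr lexx => /(_ isT (or_intror isT)).
    move=> /(le_trans (Im_le_normc _)); rewrite invE uE.
    have := frac x xr; rewrite ler_norml /m [r ^+ 2 + _]addrC.
    case: (G _) => a b; rewrite /= sqrrN mulrN mulNr !opprK; lra.
  have I2 : segint (v r) (- r) r <= - m * (r - - r).
    apply: (segint_le_cst rr) => [|y yy]; first exact: vx.
    have yr : `|y| <= r by rewrite ler_norml.
    have := near r y; rewrite nr lexx => /(_ isT yr (or_introl isT)).
    move=> /(le_trans (Re_le_normc _)); rewrite invE vE.
    have := frac y yr; rewrite ler_norml /m.
    case: (G _) => a b; rewrite /=; lra.
  have I3 : segint (u ^~ r) (- r) r <= - m * (r - - r).
    apply: (segint_le_cst rr) => [|x xx]; first exact: uy.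
    have xr : `|x| <= r by rewrite ler_norml.
    have := near x r xr; rewrite nr lexx => /(_ isT (or_intror isT)).
    move=> /(le_trans (Im_le_normc _)); rewrite invE uE.
    have := frac x xr; rewrite ler_norml /m [r ^+ 2 + _]addrC.
    case: (G _) => a b; rewrite /=; lra.
  have I4 : m * (r - - r) <= segint (v (- r)) (- r) r.
    apply: (segint_ge_cst rr) => [|y yy]; first exact: vx.
    have yr : `|y| <= r by rewrite ler_norml.
    have := near (- r) y; rewrite nNr lexx => /(_ isT yr (or_introl isT)).
    move=> /(le_trans (Re_le_normc _)); rewrite invE vE.
    have := frac y yr; rewrite ler_norml /m.
    case: (G _) => a b; rewrite /= sqrrN mulrN mulNr; lra.
  rewrite -mE /rect_loop; move: I1 I2 I3 I4; rewrite mulNr; lra.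
have loop_le : rect_loop u v (- q) q (- q) q <= 16.
  have q0 : 0 < q by rewrite invr_gt0.
  have qq : - q <= q by lra.
  have G4 x y : `|x| <= q -> `|y| <= q -> q <= `|x| \/ q <= `|y| ->
      normc (G (x +i* y)) <= 4.
    move=> xq yq xy; set z := x +i* y.
    have qz : q <= normc z.
      by case: xy => ?; [have := Re_le_normc z|have := Im_le_normc z]; rewrite /=; lra.
    have zD : unit_disc z.
      apply/discE; rewrite -(@ltr_pXn2r _ 2) ?nnegrE ?normc_ge0// normc_sqr/= expr1n.
      by move: xq yq; rewrite /q !ler_norml => ? ?; nra.
    rewrite /G Normc.normcM k1 mul1r Normc.normcM Normc.normcV normcX.
    have nz : 0 < normc z by lra.
    rewrite ler_pdivrMr ?exprn_gt0// (le_trans (H1 _ zD))//.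
    by move: qz; rewrite /q; nra.
  have nq : `|q| = q by rewrite gtr0_norm.
  have nNq : `|- q| = q by rewrite normrN.
  have uy y : `|y| = q -> seg_continuous (u ^~ y) (- q) q.
    move=> yr x xx; have xr : `|x| <= q by rewrite ler_norml.
    by have [] := cauchy_riemann_continuous (CR q x y q0 _ _ _);
      rewrite ?yr//; right.
  have vx x : `|x| = q -> seg_continuous (v x) (- q) q.
    move=> xr y yy; have yr : `|y| <= q by rewrite ler_norml.
    by have [] := cauchy_riemann_continuous (CR q x y q0 _ _ _);
      rewrite ?xr//; left.
  have uB x y : `|y| = q -> - q <= x <= q -> -4 <= u x y <= 4.
    move=> yq xx; have xq : `|x| <= q by rewrite ler_norml.
    have := G4 x y xq; rewrite yq lexx => /(_ isT (or_intror isT)).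
    by move=> /(le_trans (Im_le_normc _)); rewrite uE ler_norml.
  have vB x y : `|x| = q -> - q <= y <= q -> -4 <= v x y <= 4.
    move=> xq yy; have yq : `|y| <= q by rewrite ler_norml.
    have := G4 x y; rewrite xq lexx => /(_ isT yq (or_introl isT)).
    by move=> /(le_trans (Re_le_normc _)); rewrite vE ler_norml; lra.
  have I1 : segint (u ^~ (- q)) (- q) q <= 4 * (q - - q).
    by apply: (segint_le_cst qq) => [|x /(uB x _ nNq)/andP[]//]; exact: uy.
  have I2 : -4 * (q - - q) <= segint (v q) (- q) q.
    by apply: (segint_ge_cst qq) => [|x /(vB _ x nq)/andP[]//]; exact: vx.
  have I3 : -4 * (q - - q) <= segint (u ^~ q) (- q) q.
    by apply: (segint_ge_cst qq) => [|x /(uB x _ nq)/andP[]//]; exact: uy.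
  have I4 : segint (v (- q)) (- q) q <= 4 * (q - - q).
    by apply: (segint_le_cst qq) => [|x /(vB _ x nNq)/andP[]//]; exact: vx.
  have qE : q - - q = 1 by rewrite /q; lra.
  move: I1 I2 I3 I4; rewrite /rect_loop qE; lra.
apply/ler_addgt0Pr => e e0.
have e2 : 0 < e / 2 by rewrite divr_gt0.
have := le_trans (loop_ge _ e2) loop_le; lra.
Qed.

Lemma unit_discE (z : C) : unit_disc z <-> normc z < 1.
Proof. by rewrite /unit_disc/= normrc ltcR. Qed.

Lemma unit_disc0 : @unit_disc R 0.
Proof. by apply/unit_discE; rewrite Normc.normc0. Qed.

Lemma bernoulli_le (t : R) n : 0 <= t -> 1 + t * n%:R <= (1 + t) ^+ n.
Proof.
move=> t0; elim: n => [|n IH]; first by rewrite mulr0 addr0 expr0.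
rewrite exprS; apply: (@le_trans _ _ ((1 + t) * (1 + t * n%:R))); last first.
  by rewrite ler_wpM2l// addr_ge0.
have : 0 <= t * (t * n%:R) by rewrite !mulr_ge0.
rewrite -natr1; lra.
Qed.

Lemma expr_bounded_le1 (x M : R) : 0 <= x -> (forall n, x ^+ n <= M) -> x <= 1.
Proof.
move=> x0 xM; rewrite leNgt; apply/negP => x1.
have t0 : 0 < x - 1 by rewrite subr_gt0.
have M0 : 0 <= M by apply: le_trans (xM 0%N); rewrite expr0.
have h : 0 <= M / (x - 1) by rewrite divr_ge0// ltW.
have := archi_boundP h; set n := Num.bound _ => nM.
have := bernoulli_le n (ltW t0); rewrite subrKC => /le_trans/(_ (xM n)) {}h.
move: nM; rewrite ltr_pdivrMr// [n%:R * _]mulrC; lra.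
Qed.

Lemma diff_comp_fix0 (H G : C -> C) : differentiable G 0 -> differentiable H 0 ->
  G 0 = 0 -> 'd (H \o G) 0 1 = 'd G 0 1 * 'd H 0 1.
Proof.
move=> dG dH G0.
have dHG : differentiable H (G 0) by rewrite G0.
have E := congr1 (fun f => f 1) (diff_comp dG dHG).
apply: (etrans E); apply: etrans (congr1 (fun z => 'd H z ('d G 0 1)) G0) _.
exact: complex_diffE.
Qed.

(* Iterating [H] turns the crude bound 4 on the derivative into the sharp one. *)
Lemma schwarz (H : C -> C) : holomorphic_on unit_disc H ->
  (forall z, unit_disc z -> unit_disc (H z)) -> H 0 = 0 ->
  normc ('d H 0 1) <= 1.
Proof.
move=> dH HD H0.
have iD n z : unit_disc z -> unit_disc (iter n H z).
  by move=> zD; elim: n => //= n; exact: HD.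
have i0 n : iter n H 0 = 0 by elim: n => //= n ->.
have iS n : iter n.+1 H = H \o iter n H by [].
have dI n : holomorphic_on unit_disc (iter n H).
  elim: n => [|n IH] z zD; first by rewrite (_ : iter 0 H = id).
  rewrite iS; apply: differentiable_comp; first exact: IH.
  by apply: dH; rewrite inE; apply: iD; move: zD; rewrite inE.
have D0 : 0 \in @unit_disc R by rewrite inE; exact: unit_disc0.
have dE n : 'd (iter n H) 0 1 = ('d H 0 1) ^+ n.
  elim: n => [|n IH].
    by rewrite expr0 (_ : iter 0 H = id)// diff_val.
  rewrite [iter n.+1 H]iS exprSr -IH.
  exact: (diff_comp_fix0 (dI n 0 D0) (dH 0 D0) (i0 n)).
apply: (@expr_bounded_le1 _ 4); first exact: normc_ge0.
move=> n; rewrite -normcX -dE; apply: cauchy_weak => //.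
by move=> z /(iD n)/unit_discE/ltW.
Qed.

(** Composing with the disc automorphism that sends [a = h 0] to 0, of derivative
    [1 / (1 - |a| ^+ 2)] at [a], reduces to [schwarz]. *)
Lemma schwarz_pick (h : C -> C) : holomorphic_on unit_disc h ->
  (forall z, unit_disc z -> unit_disc (h z)) ->
  normc ('d h 0 1) <= 1 - normc (h 0) ^+ 2.
Proof.
move=> dh hD; set a := h 0.
have D0 : 0 \in @unit_disc R by rewrite inE; exact: unit_disc0.
have na1 : normc a < 1 by apply/unit_discE/hD/unit_disc0.
have na2 : normc a ^+ 2 < 1 by rewrite expr_lt1 ?normc_ge0.
(* The difference of the two squares is the product of [1 - |a| ^+ 2] and [1 - |h z| ^+ 2]. *)
have key z : unit_disc z ->
    normc (h z - a) ^+ 2 < normc (1 - conjc a * h z) ^+ 2.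
  move=> /hD/unit_discE hz1; have : normc (h z) ^+ 2 < 1 by rewrite expr_lt1 ?normc_ge0.
  move: na2; rewrite !normc_sqr.
  case: (h z) => x y; case: (a) => a1 a2 /= ha hz.
  have : 0 < (1 - (a1 ^+ 2 + a2 ^+ 2)) * (1 - (x ^+ 2 + y ^+ 2)).
    by rewrite mulr_gt0 ?subr_gt0.
  by clear; lra.
have den z : unit_disc z -> 0 < normc (1 - conjc a * h z).
  move=> /key; rewrite normc_gt0; apply: contraTneq => ->.
  by rewrite Normc.normc0 expr0n/= -leNgt sqr_ge0.
have den0 z : unit_disc z -> 1 - conjc a * h z != 0.
  by move=> /den; apply: contraTneq => ->; rewrite Normc.normc0 ltxx.
pose D z := 1 - conjc a * h z.
pose N z := h z - a.
have dD z : z \in unit_disc -> differentiable D z.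
  move=> zD; have -> : D = cst 1 - cst (conjc a) * h by [].
  apply: differentiableB; first exact: differentiable_cst.
  by apply: differentiableM; [exact: differentiable_cst|exact: dh].
have dN z : z \in unit_disc -> differentiable N z.
  move=> zD; have -> : N = h - cst a by [].
  by apply: differentiableB; [exact: dh|exact: differentiable_cst].
pose H := N * (fun z => (D z)^-1).
have dV z : z \in unit_disc -> differentiable (fun z => (D z)^-1) z.
  move=> zD; apply: differentiableV; first exact: dD.
  by apply: den0; move: zD; rewrite inE.
have H1 : normc ('d H 0 1) <= 1.
  apply: schwarz.
  - by move=> z zD; apply: differentiableM; [exact: dN|exact: dV].
  - move=> z zD; apply/unit_discE; rewrite /H /D /N mulrfctE Normc.normcM Normc.normcV.
    rewrite ltr_pdivrMr ?den// mul1r.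
    by have := key z zD; rewrite ltr_sqr ?nnegrE ?normc_ge0.
  - by rewrite /H /N mulrfctE subrr mul0r.
have E1 : 'd H 0 1 = N 0 * 'd (fun z => (D z)^-1) 0 1 + (D 0)^-1 * 'd N 0 1.
  exact: (congr1 (fun f => f 1) (diffM (dN 0 D0) (dV 0 D0))).
have dca : differentiable (cst a : C -> C) (0 : C) by exact: differentiable_cst.
have E2 : 'd N 0 1 = 'd h 0 1 - 'd (cst a : C -> C) (0 : C) 1.
  exact: (congr1 (fun f : C -> C => f 1) (diffB (dh 0 D0) dca)).
have E3 : 'd (cst a : C -> C) (0 : C) 1 = 0.
  exact: (congr1 (fun f : C -> C => f 1) (@diff_cst C C C a 0)).
have alg (dH0 dV0 dN0 dh0 da0 : C) : dH0 = N 0 * dV0 + (D 0)^-1 * dN0 ->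
    dN0 = dh0 - da0 -> da0 = 0 -> normc dH0 <= 1 -> normc dh0 <= 1 - normc a ^+ 2.
  rewrite /N subrr mul0r add0r => -> -> ->.
  rewrite subr0 Normc.normcM Normc.normcV /D -/a.
  have -> : 1 - conjc a * a = (1 - normc a ^+ 2)%:C.
    rewrite rmorphB/= normc_sqr; case: (a) => x y.
    by apply/eqP; rewrite eq_complex/=; apply/andP; split; apply/eqP; rewrite /=; ring.
  rewrite normc_real ger0_norm; last by lra.
  by rewrite mulrC ler_pdivrMr ?mul1r// subr_gt0.
exact: (alg _ _ _ _ _ E1 E2 E3 H1).
Qed.

(** If the disc [f] has derivative [l v] at 0, then [g \o f] is a self-map of the disc with
    derivative [l * 'd g a v], and [schwarz_pick] bounds [l] times the competitor given by [g] by
    1. *)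
Lemma caratheodory_le_kobayashi n (Omega : set 'rV[C]_n) (a v : 'rV[C]_n) :
  Omega a -> (caratheodory Omega a v <= kobayashi Omega a v)%E.
Proof.
move=> Oa; apply: ge_ereal_sup => _ [g [dg gO] <-].
apply: le_ereal_inf_tmp => _ [l [l0 [f [df fO f0 f'0]]] <-].
have D0 : 0 \in @unit_disc R by rewrite inE; exact: unit_disc0.
have dgf : holomorphic_on unit_disc (g \o f).
  move=> z zD; apply: differentiable_comp; first exact: df.
  by apply: dg; rewrite inE; apply: fO; exists z => //; move: zD; rewrite inE.
have gfD z : unit_disc z -> unit_disc ((g \o f) z).
  by move=> zD; apply: gO; exists (f z) => //; apply: fO; exists z.
have dfa : differentiable g (f 0) by rewrite f0; apply: dg; rewrite inE.
have E1 : 'd (g \o f) 0 1 = 'd g (f 0) ('d f 0 1).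
  exact: (congr1 (fun h => h 1) (diff_comp (df 0 D0) dfa)).
have E2 : 'd f 0 1 = l%:C *: v by apply: etrans f'0; apply/esym/derive1E'/df.
have E3 : 'd (g \o f) 0 1 = l%:C * 'd g a v.
  apply: (etrans E1); apply: (etrans (congr1 (fun z => 'd g (f 0) z) E2)).
  apply: (etrans (congr1 (fun z => 'd g z (l%:C *: v)) f0)); exact: linearZ.
have ga1 : normc (g a) < 1 by apply/unit_discE/gO; exists a.
have ga2 : 0 < 1 - normc (g a) ^+ 2 by rewrite subr_gt0 expr_lt1 ?normc_ge0.
have alg (x y : C) : x = l%:C * y -> normc x <= 1 - normc ((g \o f) 0) ^+ 2 ->
    (normc y / (1 - normc (g a) ^+ 2) <= 1 / l).
  move=> ->; rewrite /= f0 Normc.normcM normc_real gtr0_norm// => H.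
  by rewrite ler_pdivrMr// mul1r mulrC ler_pdivlMr// mulrC.
by rewrite lee_fin /poincare; exact: (alg _ _ E3 (schwarz_pick dgf gfD)).
Qed.
End SchwarzPick.

(** * Rational functions with positive real part on the circle *)

Section ClosedDisc.
Variable R : realType.
Local Notation C := R[i].
Local Notation normc := (@Normc.normc R).

Lemma near_normc (z : C) (e : R) : 0 < e -> \forall w \near z, normc (z - w) < e.
Proof.
move=> e0; apply/nbhs_ballP; exists e%:C; first by rewrite /= ltcR.
by move=> w; rewrite -ball_normE/= normrc ltcR.
Qed.

Lemma near_normcP (z : C) (P : set C) : (\forall w \near z, P w) ->
  exists2 e : R, 0 < e & forall w, normc (z - w) < e -> P w.
Proof.
move=> /nbhs_ballP[d d0 H].
have dE : d = (complex.Re d)%:C by rewrite RRe_real// gtr0_real.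
exists (complex.Re d); first by rewrite -ltcR -dE.
by move=> w wd; apply: H; rewrite -ball_normE/= normrc dE ltcR.
Qed.

Lemma lipschitz1_continuous (f : C -> R) :
  (forall z w, `|f z - f w| <= normc (z - w)) -> continuous f.
Proof.
move=> fl z; apply/(@cvgrPdist_lt _ _ _ (nbhs z) (nbhs_filter z)) => e e0.
near=> w; apply: le_lt_trans (fl _ _) _; near: w; exact: near_normc.
Unshelve. all: by end_near. Qed.

Lemma continuous_Re : continuous (@complex.Re R).
Proof.
apply: lipschitz1_continuous => z w; apply: le_trans (Re_le_normc _).
by case: z w => [? ?] [? ?].
Qed.

Lemma continuous_normc : continuous normc.
Proof.
apply: lipschitz1_continuous => z w.
have := normcD (z - w) w; have := normcD (w - z) z.
rewrite !subrK (normcB w) ler_norml => ? ?; apply/andP; split; lra.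
Qed.

Lemma continuous_complex (T : topologicalType) (f g : T -> R) :
  continuous f -> continuous g -> continuous (fun t => f t +i* g t).
Proof.
move=> cf cg t; apply/cvgrPdist_lt => e e0.
have eE : e = (complex.Re e)%:C by rewrite RRe_real// gtr0_real.
have e2 : 0 < complex.Re e / 2 by rewrite divr_gt0// -ltcR -eE.
have := cf t; move=> /cvgrPdist_lt/(_ _ e2) nf.
have := cg t; move=> /cvgrPdist_lt/(_ _ e2) ng.
near=> s; rewrite normrc eE ltcR.
apply: le_lt_trans (normc_le_ReIm _) _ => /=.
rewrite [X in _ < X]splitr ltrD//; near: s; assumption.
Unshelve. all: by end_near. Qed.

Lemma continuous_cpoly (p : {poly C}) : continuous (horner p).
Proof.
elim/poly_ind: p => [|p c IH] z.
  by rewrite (_ : horner 0 = cst 0); [exact: cst_continuous|apply/funext => w; rewrite horner0].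
rewrite (_ : horner _ = (horner p \* id) + cst c); last first.
  by apply/funext => w; rewrite !hornerE.
apply: continuousD; last exact: cst_continuous.
by apply: (@continuousM C C (horner p) id); [exact: IH|exact: cvg_id].
Qed.

Definition closed_disc : set C := [set z | normc z <= 1].

(** Compactness is imported from the real square [[-1, 1]^2], whose continuous image in [C] contains
    the disc. *)
Lemma compact_closed_disc : compact closed_disc.
Proof.
pose sq : set 'rV[R]_2 := [set x | forall i, `[-1, 1]%classic (x ord0 i)].
pose f (x : 'rV[R]_2) : C := x ord0 ord0 +i* x ord0 ord_max.
have cf : continuous f.
  by apply: continuous_complex => x; exact: coord_continuous.
have csq : compact sq.
  exact: (@rV_compact R 2 (fun=> `[-1, 1]%classic) (fun=> @segment_compact R (-1) 1)).
apply: (@subclosed_compact _ _ (f @` sq)).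
- rewrite (_ : closed_disc = normc @^-1` [set x | x <= 1])//.
  by apply: preimage_closed; [move=> z _; exact: continuous_normc|exact: closed_le].
- by apply: continuous_compact => //; exact: continuous_subspaceT.
- move=> z z1; exists (\row_(i < 2) if i == ord0 then complex.Re z else complex.Im z).
    move=> i; rewrite /= mxE in_itv/= -ler_norml; case: ifP => _.
      exact: le_trans (Re_le_normc _) z1.
    exact: le_trans (Im_le_normc _) z1.
  by rewrite /f !mxE/=; case: z z1.
Qed.

Lemma closed_disc_min (f : C -> R) : {in closed_disc, continuous f} ->
  exists2 z, normc z <= 1 & forall w, normc w <= 1 -> f z <= f w.
Proof.
move=> cf; have [||z] := @compact_EVT_min _ _ f closed_disc _ compact_closed_disc.
- by exists 0; rewrite /closed_disc /mkset Normc.normc0.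
- exact: continuous_in_subspaceT.
- rewrite inE => z1 zm; exists z => // w w1; apply: zm; rewrite inE; exact: w1.
Qed.

End ClosedDisc.

Section PositiveRealPart.
Variable R : realType.
Local Notation C := R[i].
Local Notation normc := (@Normc.normc R).

Lemma Re_div (x y : C) :
  complex.Re (x / y) = complex.Re (x * conjc y) / normc y ^+ 2.
Proof. by rewrite normc_sqr; case: x y => [a b] [c d] /=; ring. Qed.

(* The local minimum principle for the real part of the rational function
   [A / B], read off its leading term at the minimum. *)
Lemma positive_circle_neq0 (A B : {poly C}) :
  (forall z, normc z <= 1 -> B.[z] != 0) ->
  (forall z, normc z = 1 -> 0 < complex.Re (A.[z] * conjc B.[z])) ->
  forall z, normc z < 1 -> A.[z] != 0.
Proof.
move=> B0 AB b b1; apply/eqP => Ab.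
pose F z := complex.Re (A.[z] / B.[z]).
have Fpos z : normc z = 1 -> 0 < F z.
  move=> z1; rewrite /F Re_div divr_gt0 ?AB// exprn_gt0// normc_gt0.
  by apply: B0; rewrite z1.
have [|z1 z1D zmin] := @closed_disc_min _ F.
  move=> z; rewrite inE => zD; rewrite /F.
  apply: (@continuous_comp _ _ _ (fun z => A.[z] / B.[z])); last exact: continuous_Re.
  apply: (@continuousM C C (horner A) (fun z => B.[z]^-1)).
    exact: continuous_cpoly.
  by apply: (@continuousV C C (horner B)); [exact: B0|exact: continuous_cpoly].
have Fz1 : F z1 <= 0.
  by apply: le_trans (zmin b (ltW b1)) _; rewrite /F Ab mul0r.
have z1lt : normc z1 < 1.
  rewrite lt_neqAle z1D andbT; apply/eqP => z1E.
  by have := Fpos _ z1E; rewrite ltNge Fz1.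
(* The numerator of [A / B] minus its value at [z1], over the denominator [B.[z] * B.[z1]]. *)
pose P := B.[z1] *: A - A.[z1] *: B.
have PE z : normc z <= 1 ->
    A.[z] / B.[z] = A.[z1] / B.[z1] + P.[z] / (B.[z] * B.[z1]).
  by move=> zD; rewrite /P !hornerE; field; rewrite !B0.
have [P0|P0] := eqVneq P 0.
  have n1 : normc (1 : C) = 1 by rewrite Normc.normc1.
  have := Fpos _ n1.
  by rewrite /F PE ?n1// P0 horner0 mul0r addr0 ltNge Fz1.
have [k [P1]] := multiplicity_XsubC P z1; rewrite P0/= => P1z PP1.
have k0 : (0 < k)%N.
  case: k PP1 => // PP1; move: P1z.
  have -> : P1 = P by rewrite PP1 expr0 mulr1.
  by rewrite /root /P !hornerE mulrC subrr eqxx.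
have s0 : P1.[z1] != 0 by [].
pose S z := P1.[z] / (B.[z] * B.[z1]).
have Sz1 : S z1 != 0 by rewrite mulf_neq0 ?invr_neq0 ?mulf_neq0 ?B0.
(* The direction along which the leading term [S z1 * (z - z1) ^+ k] is a negative real. *)
pose eta := k.-root (- (S z1)^-1).
have etaE : eta ^+ k = - (S z1)^-1 by rewrite rootCK.
have eta0 : eta != 0.
  by apply: contraNneq Sz1 => e0; move: etaE; rewrite e0 expr0n gtn_eqF// => /eqP;
    rewrite eq_sym oppr_eq0 invr_eq0.
have cS : {for z1, continuous (fun z => complex.Re (eta ^+ k * S z))}.
  suff cS' : {for z1, continuous (cst (eta ^+ k) \* S)}.
    by apply: (@continuous_comp C C R (cst (eta ^+ k) \* S) (@complex.Re R) z1 cS');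
      exact: continuous_Re.
  apply: (@continuousM C C (cst (eta ^+ k)) S); first exact: cst_continuous.
  apply: (@continuousM C C (horner P1) (fun z => (B.[z] * B.[z1])^-1)).
    exact: continuous_cpoly.
  have cB : {for z1, continuous (horner B \* cst B.[z1])}.
    apply: (@continuousM C C (horner B) (cst B.[z1])); first exact: continuous_cpoly.
    exact: cst_continuous.
  apply: (@continuousV C C (horner B \* cst B.[z1]) z1 _ cB).
  by rewrite /= mulf_neq0 ?B0.
have ReS : complex.Re (eta ^+ k * S z1) = -1 by rewrite etaE mulNr mulVf.
have := cS; move=> /cvgrPdist_lt/(_ 1 ltr01)/near_normcP[e e0 He].
have neta : 0 < normc eta by rewrite normc_gt0.
(* The step has length [min (e / 2) (1 - |z1|)]: it stays where [S] is controlled and in the closed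
   disc. *)
pose t := Num.min (e / 2) (1 - normc z1) / normc eta.
have t0 : 0 < t by rewrite divr_gt0// lt_min divr_gt0// subr_gt0.
pose z := z1 + t%:C * eta.
have zz1 : normc (z1 - z) = Num.min (e / 2) (1 - normc z1).
  rewrite normcB /z addrAC subrr add0r Normc.normcM normc_real gtr0_norm//.
  by rewrite divfK// gt_eqF.
have zD : normc z <= 1.
  have := normcD z1 (t%:C * eta); rewrite -/z.
  have -> : normc (t%:C * eta) = normc (z1 - z) by rewrite normcB /z addrAC subrr add0r.
  rewrite zz1 => /le_trans; apply.
  have : Num.min (e / 2) (1 - normc z1) <= 1 - normc z1 by rewrite ge_min lexx orbT.
  lra.
have /He : normc (z1 - z) < e.
  by rewrite zz1 gt_min; apply/orP; left; lra.
rewrite ReS => HS.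
have {}HS : complex.Re (eta ^+ k * S z) < 0 by move: HS; rewrite ltr_norml; lra.
have := zmin z zD; apply/negP; rewrite -ltNge.
rewrite /F PE// PP1 !hornerE.
rewrite (_ : _ / (B.[z] * B.[z1]) = (t ^+ k)%:C * (eta ^+ k * S z)); last first.
  rewrite /S rmorphXn/= /z addrAC subrr add0r exprMn -!mulrA.
  by rewrite mulrCA; congr (_ * _); rewrite mulrCA.
have tk : 0 < t ^+ k by rewrite exprn_gt0.
move: HS; move: (eta ^+ k * S z) => [x y] /= HS.
case: (A.[z1] / B.[z1]) => x' y' /=; rewrite mul0r subr0.
by rewrite gtrDl pmulr_rlt0.
Qed.

(** Two uses of [positive_circle_neq0] replace the argument principle. If [q] had no root in the
    closed disc, the pair ['X], [q] would forbid the root 0 of ['X]. For uniqueness the pair is [p],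
    [1 - conjc al *: 'X]: on the circle [z - al = z (1 - al conj z)], so the hypothesis on [q] is
    the positivity required of this pair. *)
Lemma unique_root_disc (q : {poly C}) :
  (forall z, normc z = 1 -> 0 < complex.Re (q.[z] * conjc z)) ->
  exists al p, [/\ q = p * ('X - al%:P), normc al < 1 &
    forall z, normc z <= 1 -> p.[z] != 0].
Proof.
move=> qpos.
have qcirc z : normc z = 1 -> q.[z] != 0.
  by move=> /qpos; apply: contraTneq => ->; rewrite mul0r ltxx.
have [al al1 qal] : exists2 al, normc al <= 1 & q.[al] = 0.
  apply: contrapT => /forall2NP nq.
  have q0 z : normc z <= 1 -> q.[z] != 0.
    by move=> z1; apply/eqP => qz; case: (nq z).
  have := @positive_circle_neq0 'X q q0.
  move=> /(_ _ 0); rewrite Normc.normc0 ltr01 hornerX eqxx => H.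
  suff : false by []; apply: H => // z z1; rewrite hornerX.
  by have := qpos z z1; case: z {z1} => a b; case: q.[_] => c d /=; lra.
have al1' : normc al < 1.
  by rewrite lt_neqAle al1 andbT; apply: contraPneq qal => /qcirc/eqP.
have /factor_theorem[p qE] : root q al by apply/rootP.
exists al, p; split => // b b1; apply/eqP => pb.
have qb : q.[b] = 0 by rewrite qE hornerM pb mul0r.
have {}b1 : normc b < 1.
  by rewrite lt_neqAle b1 andbT; apply: contraPneq qb => /qcirc/eqP.
have := @positive_circle_neq0 p (1 - conjc al *: 'X).
move=> /(_ _ _ b b1); rewrite pb eqxx => H.
suff : false by []; apply: H => z z1.
  rewrite !hornerE subr_eq0; apply/eqP => /(congr1 normc).
  have naj : normc (conjc al) = normc al by apply: complexI; rewrite -!normrc normcJ.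
  rewrite Normc.normc1 Normc.normcM naj => E.
  suff : normc al * normc z < 1 by rewrite -E ltxx.
  apply: le_lt_trans al1'; rewrite -[X in _ <= X]mulr1.
  by rewrite ler_wpM2l ?normc_ge0.
have := qpos z z1; rewrite qE !hornerE.
have : normc z ^+ 2 = 1 by rewrite z1 expr1n.
rewrite normc_sqr; case: (p.[z]) al {qE pb qb qal al1 al1'} => [p1 p2] [a1 a2].
case: z {z1} => x y /= xy.
set g := (X in 0 < X -> _); set h := (X in _ -> 0 < X).
suff -> : h = g + (p1) * (1 - (x ^+ 2 + y ^+ 2)) by rewrite xy subrr mulr0 addr0.
rewrite /g /h; ring.
Qed.

End PositiveRealPart.

(** * The root of an affine family of polynomials *)

Section LinearForms.
Variables (R : realType) (n : nat).
Local Notation C := R[i].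
Local Notation normc := (@Normc.normc R).

(** The norm of a normed module over [C] is [C]-valued; its real part makes the order of [R]
    available. *)
Definition rvnorm (h : 'rV[C]_n) : R := complex.Re `|h|.

Lemma rvnormE (h : 'rV[C]_n) : `|h| = (rvnorm h)%:C.
Proof. by rewrite /rvnorm RRe_real// ger0_real. Qed.

Lemma rvnorm_ge0 h : 0 <= rvnorm h.
Proof. by rewrite -ler0c -rvnormE. Qed.

Lemma normc_coord_le (h : 'rV[C]_n) j : normc (h ord0 j) <= rvnorm h.
Proof.
apply/ler_addgt0Pr => e e0.
have : ball (0 : 'rV[C]_n) (rvnorm h + e)%:C h.
  by rewrite -ball_normE/= sub0r normrN rvnormE ltcR ltrDl.
by case=> _ /(_ ord0 j); rewrite -ball_normE/= mxE sub0r normrN normrc ltcR => /ltW.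
Qed.

(** Bilinear, without conjugation, hence holomorphic in [h]. *)
Definition rvdot (h : 'rV[C]_n) (c : 'I_n -> C) : C := \sum_j h ord0 j * c j.

Lemma rvdot_is_linear c : linear (rvdot^~ c).
Proof.
move=> k x y; rewrite /rvdot scaler_sumr -big_split; apply: eq_bigr => j _.
by rewrite !mxE mulrDl -mulrA.
Qed.

Lemma rvdotB x y c : rvdot (x - y) c = rvdot x c - rvdot y c.
Proof. by rewrite /rvdot -sumrB; apply: eq_bigr => j _; rewrite !mxE mulrBl. Qed.

Lemma normc_sum (I : finType) (F : I -> C) : normc (\sum_i F i) <= \sum_i normc (F i).
Proof.
elim/big_ind2: _ => [|x a y b xa yb|//]; first by rewrite Normc.normc0.
exact: le_trans (normcD _ _) (lerD xa yb).
Qed.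

Lemma normc_rvdot h c (e : R) : (forall j, normc (c j) <= e) ->
  normc (rvdot h c) <= n%:R * e * rvnorm h.
Proof.
move=> ce; apply: le_trans (normc_sum _) _.
apply: (@le_trans _ _ (\sum_(j < n) rvnorm h * e)).
  apply: ler_sum => j _; rewrite Normc.normcM ler_pM ?normc_ge0//.
  exact: normc_coord_le.
by rewrite sumr_const card_ord -[leLHS]mulr_natl mulrCA mulrC.
Qed.

Lemma continuous_rvdot c : continuous (rvdot^~ c).
Proof.
rewrite (_ : rvdot^~ c =
  \sum_(j < n) ((fun h : 'rV[C]_n => h ord0 j) * cst (c j))); last first.
  by apply/funext => h; rewrite fct_sumE.
move=> h; apply: differentiable_continuous; apply: differentiable_sum => j.
by apply: differentiableM; [exact: differentiable_coord|exact: differentiable_cst].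
Qed.

Lemma near_differentiable_rvdot (f : 'rV[C]_n -> C) x c :
  (forall e : R, 0 < e -> \forall h \near (0 : 'rV[C]_n),
    normc (f (h + x) - (f x + rvdot h c)) <= e * rvnorm h) ->
  differentiable f x /\ (forall v, 'd f x v = rvdot v c).
Proof.
move=> H.
pose LM := GRing.isLinear.Build _ _ _ _ _ (rvdot_is_linear c).
pose L : {linear 'rV[C]_n -> C} := HB.pack (rvdot^~ c) LM.
have [|e e0|df dE] := @near_differentiable C 'rV[C]_n C f x L.
- exact: continuous_rvdot.
- have eE : e = (complex.Re e)%:C by rewrite RRe_real// gtr0_real.
  have := H (complex.Re e); rewrite -ltcR -eE => /(_ e0).
  apply: filterS => h; rewrite -lecR rmorphM/= -eE -rvnormE -normrc; exact.
- by split => // v; rewrite dE.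
Qed.

Lemma near_rvnorm (d : R) : 0 < d -> \forall h \near (0 : 'rV[C]_n), rvnorm h < d.
Proof.
move=> d0; apply/nbhs_ballP; exists d%:C; first by rewrite /= ltcR.
by move=> h; rewrite -ball_normE/= sub0r normrN rvnormE ltcR.
Qed.

End LinearForms.

Section RootFunction.
Variables (R : realType) (n : nat).
Local Notation C := R[i].
Local Notation normc := (@Normc.normc R).

Lemma closed_disc_bound (f : C -> C) : {in @closed_disc R, continuous f} ->
  exists2 M : R, 0 <= M & forall z, normc z <= 1 -> normc (f z) <= M.
Proof.
move=> cf; have [z zD|z z1 zm] := @closed_disc_min R (fun z => - normc (f z)).
  apply: (@continuousN _ R _ (normc \o f)).
  by apply: continuous_comp; [exact: cf|exact: continuous_normc].
exists (normc (f z)); first exact: normc_ge0.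
by move=> w /zm; rewrite lerN2.
Qed.

(** Since [q z] is affine in [z], its root has an exact increment formula, and no implicit function
    theorem is needed. *)
Lemma root_function (Omega : set 'rV[C]_n) (a : 'rV[C]_n) (U : {poly C})
    (Phi : 'I_n -> {poly C}) : open Omega -> Omega a ->
  (forall z, Omega z -> forall zeta, normc zeta = 1 ->
    0 < complex.Re ((zeta * U.[zeta] - rvdot (z - a) (fun j => (Phi j).[zeta]))
                    * conjc zeta)) ->
  U.[0] != 0 /\ exists g : 'rV[C]_n -> C,
    [/\ holomorphic_on Omega g, forall z, Omega z -> normc (g z) < 1, g a = 0 &
     forall v, 'd g a v = rvdot v (fun j => (Phi j).[0]) / U.[0]].
Proof.
move=> oO Oa qpos.
pose q z : {poly C} := 'X * U - \sum_j (z - a) ord0 j *: Phi j.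
have qE z zeta : (q z).[zeta] =
    zeta * U.[zeta] - rvdot (z - a) (fun j => (Phi j).[zeta]).
  rewrite /q !hornerE horner_sum; congr (_ - _).
  by apply: eq_bigr => j _; rewrite hornerZ.
have ex z : exists w, Omega z -> exists p : {poly C},
    [/\ q z = p * ('X - w%:P), normc w < 1 & forall b, normc b <= 1 -> p.[b] != 0].
  have [Oz|nOz] := pselect (Omega z); last by exists 0.
  have [|w [p H]] := @unique_root_disc _ (q z); last by exists w => _; exists p.
  by move=> b b1; rewrite qE; exact: qpos.
have [g gP] := choice ex.
have g1 z : Omega z -> normc (g z) < 1 by move=> /gP[p []].
have qg z : Omega z -> (q z).[g z] = 0.
  by move=> /gP[p [-> _ _]]; rewrite !hornerE subrr mulr0.
have ga : g a = 0.
  have [p [qp _ p0]] := gP a Oa.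
  have : (q a).[0] = 0.
    rewrite qE mul0r subrr /rvdot big1 ?subr0// => j _; by rewrite mxE mul0r.
  rewrite qp !hornerE ?sub0r => /eqP; rewrite mulf_eq0 (negbTE (p0 _ _)) ?oppr_eq0.
    by move/eqP.
  by rewrite Normc.normc0.
have main z0 p : Omega z0 -> q z0 = p * ('X - (g z0)%:P) ->
    (forall b, normc b <= 1 -> p.[b] != 0) ->
    differentiable g z0 /\
    forall v, 'd g z0 v = rvdot v (fun j => (Phi j).[g z0] / p.[g z0]).
  move=> Oz0 qp p0; apply: near_differentiable_rvdot => e e0.
  pose Psi j b := (Phi j).[b] / p.[b].
  have cPsi j b : normc b <= 1 -> {for b, continuous (Psi j)}.
    move=> b1; apply: (@continuousM C C (horner (Phi j)) (fun b => p.[b]^-1)).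
      exact: continuous_cpoly.
    by apply: (@continuousV C C (horner p)); [exact: p0|exact: continuous_cpoly].
  have [M M0 PsiM] : exists2 M : R, 0 <= M & forall j b, normc b <= 1 -> normc (Psi j b) <= M.
    have ex' j : exists M : R, 0 <= M /\ forall z, normc z <= 1 -> normc (Psi j z) <= M.
      have [|M M0 H] := @closed_disc_bound (Psi j); last by exists M.
      by move=> b; rewrite inE; exact: cPsi.
    have [M HM] := choice ex'.
    exists (\sum_j M j); first by apply: sumr_ge0 => j _; case: (HM j).
    move=> j b b1; rewrite (bigD1 j)//=; apply: le_trans ((HM j).2 _ b1) _.
    by rewrite lerDl; apply: sumr_ge0 => k _; case: (HM k).
  (* Evaluate [q (h + z0)], which is [q z0] minus a term linear in [h], at the new root. Boundedness
     of [Psi] then gives continuity of [g], and continuity of [Psi] gives its derivative. *)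
  have incr h : Omega (h + z0) -> g (h + z0) - g z0 = rvdot h (Psi^~ (g (h + z0))).
    move=> Oh; have := qg _ Oh.
    have -> : (q (h + z0)).[g (h + z0)] =
        (q z0).[g (h + z0)] - rvdot h (fun j => (Phi j).[g (h + z0)]).
      rewrite !qE -addrA; set c := fun j => _.
      have -> : rvdot (h + (z0 - a)) c = rvdot h c + rvdot (z0 - a) c.
        by rewrite /rvdot -big_split; apply: eq_bigr => j _; rewrite mxE mulrDl.
      ring.
    rewrite qp !hornerE => /eqP; rewrite subr_eq0 => /eqP E.
    have pg : p.[g (h + z0)] != 0 by apply: p0; exact/ltW/g1.
    apply: (mulfI pg); rewrite E /rvdot mulr_sumr; apply: eq_bigr => j _.
    by rewrite /Psi; field.
  have e' : 0 < e / (n%:R + 1) by rewrite divr_gt0// ltr_wpDl.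
  have nPsi : \forall b \near g z0, forall j, normc (Psi j b - Psi j (g z0)) <= e / (n%:R + 1).
    apply: (@filter_forall _ _ _ (nbhs (g z0)) (nbhs_filter (g z0))) => j.
    have gz1 : normc (g z0) <= 1 by exact/ltW/g1.
    have nb := @near_normc _ (Psi j (g z0)) _ e'.
    have /near_normcP[d d0 Hd] := cPsi j _ gz1 _ nb.
    near=> b; rewrite normcB; apply/ltW/Hd; near: b; exact: near_normc.
  have [d d0 Hd] := near_normcP nPsi.
  have d' : 0 < d / (n%:R * M + 1) by rewrite divr_gt0// ltr_wpDl// mulr_ge0.
  have nO : \forall h \near (0 : 'rV[C]_n), Omega (h + z0).
    have := oO; rewrite openE => /(_ _ Oz0).
    by rewrite /interior -[X in nbhs X](add0r z0) => /nbhsDl.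
  have nh := @near_rvnorm R n _ d'.
  near=> h.
  have Oh : Omega (h + z0) by near: h.
  have hd : rvnorm h < d / (n%:R * M + 1) by near: h.
  have gh1 : normc (g (h + z0)) <= 1 by exact/ltW/g1.
  rewrite opprD addrA incr//.
  have -> : rvdot h (Psi^~ (g (h + z0))) - rvdot h (fun j => (Phi j).[g z0] / p.[g z0]) =
      rvdot h (fun j => Psi j (g (h + z0)) - Psi j (g z0)).
    by rewrite /rvdot -sumrB; apply: eq_bigr => j _; rewrite mulrBr.
  have gd : normc (g z0 - g (h + z0)) < d.
    rewrite normcB incr//; apply: le_lt_trans (normc_rvdot h (fun j => PsiM j _ gh1)) _.
    move: hd; rewrite ltr_pdivlMr ?ltr_wpDl ?mulr_ge0// => hd.
    apply: le_lt_trans hd; rewrite mulrC ler_wpM2l ?rvnorm_ge0// lerDl//.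
  apply: le_trans (normc_rvdot _ (Hd _ gd)) _.
  rewrite ler_wpM2r ?rvnorm_ge0// mulrCA -[leRHS]mulr1 ler_wpM2l ?(ltW e0)//.
  by rewrite ler_pdivrMr ?ltr_wpDl// mul1r lerDl.
have [p [qp _ p0]] := gP a Oa.
(* [q a] is ['X * U]: its root is 0 and its cofactor is [U]. *)
have pU : p = U.
  apply: (@mulIf _ 'X); first by rewrite polyX_eq0.
  move: qp; rewrite ga subr0 => <-.
  rewrite /q big1 ?subr0 1?mulrC// => j _.
  by rewrite subrr mxE scale0r.
have U0 : U.[0] != 0 by rewrite -pU; apply: p0; rewrite Normc.normc0.
split => //; exists g; split => //.
  move=> z; rewrite inE => Oz; have [pz [qz _ pz0]] := gP z Oz.
  exact: (main z pz Oz qz pz0).1.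
move=> v; rewrite (main a p Oa qp p0).2 ga pU /rvdot mulr_suml.
by apply: eq_bigr => j _; rewrite mulrA.
Unshelve. all: by end_near. Qed.

End RootFunction.

(** * Fejer kernel and roots of unity *)

Section FejerWeights.
Variable R : realType.
Local Notation C := R[i].
Local Notation normc := (@Normc.normc R).

(* [d] times the Fejer kernel of order [d] is the real part of [fejer d]. *)
Definition fejer_coef (d k : nat) : C := (if k == 0%N then d else 2 * (d - k))%N%:R.
Definition fejer (d : nat) (z : C) : C := \sum_(k < d) fejer_coef d k * z ^+ k.

(** With [S] the partial sum, [fejer] grows by [1 + 2 z S] while
    [|1 + z S|^2 = 1 + 2 Re (z S) + |z S|^2]. On the circle this is the classical identity; inside,
    [|z S| <= |S|] keeps an inequality, so the kernel can average at interior points as well. *)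
Lemma fejer_ge_sqr d z : normc z <= 1 ->
  normc (\sum_(k < d) z ^+ k) ^+ 2 <= complex.Re (fejer d z).
Proof.
move=> z1; elim: d => [|d IH].
  by rewrite /fejer !big_ord0 Normc.normc0 expr0n.
set S := \sum_(k < d) z ^+ k in IH.
have SE : \sum_(k < d.+1) z ^+ k = 1 + z * S.
  rewrite big_ord_recl expr0 /S mulr_sumr; congr (_ + _).
  by apply: eq_bigr => k _; rewrite /= exprS.
have WE : fejer d.+1 z = fejer d z + (1 + 2 * (z * S)).
  have -> : fejer d z = \sum_(k < d.+1) fejer_coef d k * z ^+ k.
    rewrite big_ord_recr /= [X in _ + X]mulr_natl /fejer_coef.
    by case: d {IH S SE} => [|d] /=; rewrite ?subnn ?muln0 mulr0n addr0.
  have -> : 1 + 2 * (z * S) = \sum_(k < d.+1) (if k == ord0 then 1 else 2) * z ^+ k.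
    rewrite big_ord_recl expr0 mulr1/= /S !mulr_sumr; congr (_ + _).
    by apply: eq_bigr => k _; rewrite /= exprS.
  rewrite /fejer -big_split; apply: eq_bigr => k _ /=.
  rewrite -mulrDl; congr (_ * _); rewrite /fejer_coef -val_eqE/=.
  case: ifP => _; first by rewrite natr1.
  have kd : (k <= d)%N by rewrite -ltnS.
  by rewrite (subSn kd) mulnS (natrD _ 2 (2 * (d - k))%N) addrC.
have sq : normc (z * S) ^+ 2 <= normc S ^+ 2.
  rewrite Normc.normcM exprMn -[leRHS]mul1r ler_wpM2r ?sqr_ge0//.
  by rewrite expr_le1 ?normc_ge0.
rewrite SE WE; move: IH sq; rewrite !normc_sqr.
case: (z * S) => x y; case: (fejer d z) => p q; case: S {SE WE} => s t /=.
lra.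
Qed.

Lemma fejer_ge0 d z : normc z <= 1 -> 0 <= complex.Re (fejer d z).
Proof. by move=> /(fejer_ge_sqr d); apply: le_trans; rewrite sqr_ge0. Qed.

(** Displaying the frequencies [k] and [-k] separately lets averages of samples be read as discrete
    Fourier coefficients. *)
Lemma Re_fejer d z : (0 < d)%N -> (complex.Re (fejer d z))%:C =
  d%:R + \sum_(1 <= k < d) (d - k)%:R * (z ^+ k + conjc z ^+ k).
Proof.
case: d => // d _; rewrite ReJ_add /fejer rmorph_sum -big_split/= mulr_suml.
rewrite big_ord_recl /fejer_coef/= !expr0 !mulr1 conjc_nat; congr (_ + _).
  by field.
rewrite big_add1/= big_mkord; apply: eq_bigr => k _.
rewrite rmorphM/= conjc_nat rmorphXn/= natrM.
by field.
Qed.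

End FejerWeights.

Section RootsOfUnity.
Variable R : realType.
Local Notation C := R[i].
Local Notation normc := (@Normc.normc R).

Lemma prim_root_exists N : (0 < N)%N -> exists w : C, N.-primitive_root w.
Proof.
move=> N0; have [r] := closed_field_poly_normal ('X^N - 1 : {poly C}).
rewrite lead_coefXnsubC// scale1r => rE.
have sep : separable_poly ('X^N - 1 : {poly C}).
  by apply: cyclotomic.separable_Xn_sub_1; rewrite pnatr_eq0 -lt0n.
suff /hasP[w _ wN] : has N.-primitive_root r by exists w.
apply: has_prim_root => //.
- by apply/allP => w wr; rewrite /root_of_unity rE root_prod_XsubC.
- by rewrite -separable_prod_XsubC -rE.
- have := size_XnsubC (1 : C) N0; rewrite rE size_prod_XsubC => -[->//].
Qed.

Variables (N : nat) (w : C).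
Hypothesis wN : N.-primitive_root w.

Lemma prim_root_normc : normc w = 1.
Proof.
have N0 := prim_order_gt0 wN.
apply/eqP; rewrite -(@pexpr_eq1 _ _ N)// ?normc_ge0//.
by rewrite -normcX prim_expr_order// Normc.normc1.
Qed.

Lemma prim_root_conjc : conjc w * w = 1.
Proof.
have := prim_root_normc => /(congr1 (fun x => x ^+ 2)); rewrite normc_sqr.
case: w => a b /= h; apply/eqP; rewrite eq_complex/=; apply/andP; split; apply/eqP.
  by move: h; lra.
by ring.
Qed.

(** A geometric sum; keeping [i] and [k] below [N] excludes aliasing. *)
Lemma prim_root_orth i k : (i < N)%N -> (k < N)%N ->
  \sum_(j < N) (w ^+ i * conjc w ^+ k) ^+ j = (if i == k then N%:R else 0).
Proof.
move=> iN kN; have wcw : conjc w ^+ k * w ^+ k = 1.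
  by rewrite -exprMn prim_root_conjc expr1n.
case: eqP => [->|/eqP ik].
  under eq_bigr do rewrite mulrC wcw expr1n.
  by rewrite sumr_const card_ord.
set x := _ * _.
have x1 : x != 1.
  apply: contra ik => /eqP x1; have : w ^+ i == w ^+ k.
    by rewrite -[w ^+ i]mulr1 -wcw mulrA -/x x1 mul1r.
  by rewrite (eq_prim_root_expr wN) !modn_small.
apply: (mulfI (x := x - 1)); first by rewrite subr_eq0.
rewrite mulr0 -subrX1 /x exprMn -!exprM ![(_ * N)%N]mulnC !exprM.
have wN1 := prim_expr_order wN.
have cN1 : conjc w ^+ N = 1.
  by have := congr1 (fun x => x ^+ N) prim_root_conjc; rewrite /= exprMn wN1 mulr1 expr1n.
by rewrite wN1 cN1 !expr1n mulr1 subrr.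
Qed.

End RootsOfUnity.

(** * Polynomial discs and convex combinations of samples *)

Section VectorPolynomial.
Variables (R : realType) (n : nat).
Local Notation C := R[i].

Definition vpoly (d : nat) (V : nat -> 'rV[C]_n) (z : C) := \sum_(k < d) z ^+ k *: V k.

Lemma vpoly_differentiable d V z : differentiable (vpoly d V) z.
Proof.
rewrite (_ : vpoly d V = \sum_(k < d) (fun z : C => (z ^+ k : C) *: V k)); last first.
  by apply/funext => y; rewrite /vpoly fct_sumE.
apply: differentiable_sum => k.
apply: differentiableZl; apply/derivable1_diffP; exact: exprn_derivable.
Qed.

Lemma vpoly0 d V : vpoly d.+1 V 0 = V 0%N.
Proof.
rewrite /vpoly big_ord_recl expr0 scale1r big1 ?addr0// => k _.
by rewrite expr0n/= scale0r.
Qed.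

Lemma vpolyS d V z : vpoly d.+1 V z = V 0%N + z *: vpoly d (fun k => V k.+1) z.
Proof.
rewrite /vpoly big_ord_recl expr0 scale1r scaler_sumr; congr (_ + _).
by apply: eq_bigr => k _; rewrite scalerA /= exprS.
Qed.

Lemma vpoly_derive1 d V : derive1 (vpoly d.+2 V) 0 = V 1%N.
Proof.
have /differentiable_continuous c := vpoly_differentiable d.+1 (fun k => V k.+1) 0.
rewrite -(vpoly0 d (fun k => V k.+1)).
rewrite /derive1; apply: cvg_lim => //.
have c' : vpoly d.+1 (fun k => V k.+1) @ (0 : C)^' --> vpoly d.+1 (fun k => V k.+1) 0.
  by apply: cvg_within_filter; exact: c.
apply: cvg_trans c'.
apply: near_eq_cvg; near=> h.
have h0 : h != 0 by near: h; exact: nbhs_dnbhs_neq.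
rewrite addr0 vpoly0 [vpoly d.+2 V h]vpolyS addrAC subrr add0r scalerA mulVf//.
by rewrite scale1r.
Unshelve. all: by end_near. Qed.

End VectorPolynomial.

Section ConvexCombination.
Variables (R : realType) (n : nat).
Local Notation C := R[i].

Lemma convex_combination (A : set 'rV[C]_n) N (f : 'I_N -> 'rV[C]_n) (t : 'I_N -> R) :
  convex_set A -> (forall j, A (f j)) -> (forall j, 0 <= t j) -> \sum_j t j = 1 ->
  A (\sum_j (t j)%:C *: f j).
Proof.
move=> /convex_setCP cA.
(* Unnormalized weights let the induction hypothesis apply to the truncated family; a vanishing
   partial sum is the only special case. *)
suff H : (forall j, A (f j)) -> (forall j, 0 <= t j) -> 0 < \sum_j t j ->
    A ((\sum_j t j)^-1%:C *: \sum_j (t j)%:C *: f j).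
  move=> Af t0 t1; have := H Af t0; rewrite t1 ltr01 => /(_ isT).
  by rewrite invr1 scale1r.
elim: N f t => [|N IH] f t Af t0; first by rewrite big_ord0 ltxx.
rewrite !big_ord_recr/=.
set s := \sum_(j < N) _; set v := \sum_(j < N) _; set u := t ord_max.
have s0 : 0 <= s by apply: sumr_ge0.
have u0 : 0 <= u by exact: t0.
move=> su; have [s0'|s_gt0] := eqVneq s 0.
  have tz j : t (widen_ord (leqnSn N) j) = 0.
    move: s0' => /eqP; rewrite psumr_eq0// => /allP/(_ j); rewrite mem_index_enum.
    by move=> /(_ isT)/eqP.
  have -> : v = 0 by rewrite /v big1// => j _; rewrite tz scale0r.
  rewrite s0' !add0r scalerA -rmorphM/= mulVf ?scale1r//.
  by move: su; rewrite s0' add0r => /gt_eqF ->.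
have {}s_gt0 : 0 < s by rewrite lt_neqAle eq_sym s_gt0.
have := IH (fun j => f (widen_ord (leqnSn N) j)) (fun j => t (widen_ord (leqnSn N) j)).
move=> /(_ (fun=> Af _) (fun=> t0 _) s_gt0); rewrite -/s -/v => Av.
have := cA _ _ (s / (s + u)) Av (Af ord_max).
have h : 0 <= s / (s + u) <= 1.
  by rewrite divr_ge0 ?(ltW su)//= ler_pdivrMr// mul1r lerDl.
move=> /(_ h); congr A; rewrite scalerA -rmorphM/= scalerDr scalerA -rmorphM/=.
congr (_%:C *: _ + _%:C *: _).
  by field; rewrite !gt_eqF.
by rewrite -/u; field; rewrite gt_eqF.
Qed.

End ConvexCombination.

(** * Separation in finite dimension *)

Section Separation.
Variables (R : realType) (I : finType).

Let vec := 'rV[R]_#|I|.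
Let co (v : vec) (i : I) : R := v ord0 (enum_rank i).
Let mkv (x : I -> R) : vec := \row_k x (enum_val k).

Let mkvK x i : co (mkv x) i = x i.
Proof. by rewrite /co /mkv mxE enum_rankK. Qed.

Let sqd (t : I -> R) (v : vec) : R := \sum_i (co v i - t i) ^+ 2.

Let continuous_sqd t : continuous (sqd t).
Proof.
rewrite (_ : sqd t = \sum_i ((fun v => co v i) - cst (t i))
                             * ((fun v => co v i) - cst (t i))); last first.
  by apply/funext => v; rewrite /sqd fct_sumE; apply: eq_bigr => i _; rewrite expr2.
apply: (big_ind (fun f : vec -> R => continuous f)).
- exact: cst_continuous.
- by move=> f g cf cg v; apply: continuousD; [exact: cf|exact: cg].
- move=> i _ v; apply: continuousM; apply: continuousB; try exact: cst_continuous.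
    exact: coord_continuous.
  exact: coord_continuous.
Qed.

(** The functional is [t - p], with [p] the point nearest to [t] in the closure of [M]. Minimality
    makes [A] nonnegative, and the gap between the two values is the squared distance plus [A];
    strictness comes from [e], as [M] need not be closed. *)
Lemma strict_separation (M : set (I -> R)) (t : I -> R) (e : R) :
  M !=set0 ->
  (forall x y s, M x -> M y -> 0 <= s <= 1 -> M (fun i => s * x i + (1 - s) * y i)) ->
  0 < e -> (forall x, M x -> e <= \sum_i (x i - t i) ^+ 2) ->
  exists psi : I -> R, forall x, M x -> \sum_i psi i * x i < \sum_i psi i * t i.
Proof.
move=> [x0 Mx0] cM e0 Me.
pose K : set vec := closure [set v | M (co v)].
have KM x : M x -> K (mkv x).
  move=> Mx; apply: subset_closure => /=; congr M : Mx.
  by apply/funext => i; rewrite mkvK.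
pose r := sqd t (mkv x0).
(* Points no farther from [t] than [x0]: a compact part of [K] that contains the minimizers over all
   of [K]. *)
pose K' := K `&` [set v | sqd t v <= r].
have cK' : compact K'.
  pose side (k : 'I_#|I|) : set R :=
    `[t (enum_val k) - (r + 1), t (enum_val k) + (r + 1)]%classic.
  pose box : set vec := [set v | forall k, side k (v ord0 k)].
  have cbox : compact box.
    by apply: (@rV_compact R #|I| side) => k; exact: segment_compact.
  apply: subclosed_compact cbox _.
    apply: closedI; first exact: closed_closure.
    rewrite (_ : [set v | _] = sqd t @^-1` [set y | y <= r])//.
    by apply: preimage_closed; [move=> v _; exact: continuous_sqd|exact: closed_le].
  move=> v [_ /= vr] k; rewrite /side/= in_itv/=.
  have : (v ord0 k - t (enum_val k)) ^+ 2 <= r.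
    apply: le_trans vr; rewrite /sqd (bigD1 (enum_val k))//= /co enum_valK lerDl.
    by apply: sumr_ge0 => i _; rewrite sqr_ge0.
  have r0 : 0 <= r by apply: sumr_ge0 => i _; rewrite sqr_ge0.
  set y := v ord0 k; set z := t _ => yr.
  have h1 := sqr_ge0 (y - z - 1); have h2 := sqr_ge0 (y - z + 1).
  by apply/andP; split; nra.
have K'0 : K' !=set0.
  by exists (mkv x0); split; [exact: KM|rewrite /= lexx].
have [p] := compact_EVT_min K'0 cK' (continuous_subspaceT (@continuous_sqd t)).
rewrite inE => -[Kp /= pr] pmin.
have {}pmin v : K v -> sqd t p <= sqd t v.
  move=> Kv; have [vr|/ltW rv] := leP (sqd t v) r; last exact: le_trans rv.
  by apply: pmin; rewrite inE; split.
have ep : e <= sqd t p.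
  have : closed [set v | e <= sqd t v].
    rewrite (_ : [set v | _] = sqd t @^-1` [set y | e <= y])//.
    by apply: preimage_closed; [move=> v _; exact: continuous_sqd|exact: closed_ge].
  move=> /closure_id cl.
  have : K `<=` [set v | e <= sqd t v].
    by rewrite cl; apply: closureS => v /= /Me.
  by move=> /(_ _ Kp).
(* Only segments from points of [M] to [p] are needed; they are limits of segments inside [M]. *)
have segK x s : M x -> 0 <= s <= 1 -> K (s *: mkv x + (1 - s) *: p).
  move=> Mx s01 B nB.
  have cphi : {for p, continuous (cst (s *: mkv x) + (fun v : vec => (1 - s) *: v))}.
    by apply: continuousD; [exact: cst_continuous|exact: scaler_continuous].
  have [m [/= Mm Bm]] := Kp _ (cphi _ nB).
  exists (s *: mkv x + (1 - s) *: m); split => //=.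
  have := cM _ _ _ Mx Mm s01; congr M; apply/funext => i.
  by rewrite -[x i]mkvK /co !mxE.
exists (fun i => t i - co p i) => x Mx.
pose A := \sum_i (co p i - t i) * (x i - co p i).
pose Q := \sum_i (x i - co p i) ^+ 2.
have Q0 : 0 <= Q by apply: sumr_ge0 => i _; rewrite sqr_ge0.
have sqdE s : sqd t (s *: mkv x + (1 - s) *: p) = sqd t p + s * (2 * A) + s ^+ 2 * Q.
  rewrite /sqd /A /Q !mulr_sumr -!big_split; apply: eq_bigr => i _ /=.
  have -> : co (s *: mkv x + (1 - s) *: p) i = s * x i + (1 - s) * co p i.
    by rewrite -[x i]mkvK /co !mxE.
  by ring.
have A0 : 0 <= A.
  rewrite leNgt; apply/negP => A0.
  (* This step gives [s Q < - A], so [2 A + s Q < 0] and the distance would decrease. *)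
  pose s := - A / (Q - A + 1).
  have d0 : 0 < Q - A + 1 by lra.
  have s0 : 0 < s by rewrite divr_gt0// oppr_gt0.
  have sQ : s * (Q - A + 1) = - A by rewrite /s divfK// gt_eqF.
  have s1 : s <= 1 by rewrite ler_pdivrMr//; lra.
  have := pmin _ (segK x s Mx _); rewrite sqdE (ltW s0) s1 => /(_ isT).
  rewrite -addrA lerDl expr2 -mulrA -mulrDr pmulr_rge0//.
  nra.
have : \sum_i (t i - co p i) * t i - \sum_i (t i - co p i) * x i = sqd t p + A.
  by rewrite /sqd /A -sumrB -big_split; apply: eq_bigr => i _ /=; ring.
lra.
Qed.

End Separation.

(** * Discrete moments and the two extremal problems *)

Section Moments.
Variables (R : realType) (N d : nat) (w : R[i]).
Local Notation C := R[i].
Local Notation normc := (@Normc.normc R).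
Hypotheses (wN : N.-primitive_root w) (d2 : (1 < d)%N) (dN : (2 * d <= N)%N).
Local Notation wb := (conjc w).

Let d0 : (0 < d)%N. Proof. exact: ltnW. Qed.
Let N0 : (0 < N)%N. Proof. exact: prim_order_gt0 wN. Qed.
Let NC0 : (N%:R : C) != 0. Proof. by rewrite pnatr_eq0 -lt0n. Qed.
Let dC0 : (d%:R : C) != 0. Proof. by rewrite pnatr_eq0 -lt0n. Qed.
Let dltN : (d < N)%N.
Proof. by apply: leq_trans dN; rewrite mul2n -addnn -{1}[d]addn0 ltn_add2l. Qed.

Let wwb : w * wb = 1.
Proof. by rewrite mulrC (prim_root_conjc wN). Qed.

(** A discrete convolution with the Fejer kernel. The target is an arbitrary [lmodType] so as to
    serve for vectors and, through [C^o], for scalars. *)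
Lemma fejer_sum (V : lmodType C) (f : 'I_N -> V) (z : C) :
  \sum_(j < N) (complex.Re (fejer d (z * wb ^+ j)))%:C *: f j =
  d%:R *: \sum_j f j + \sum_(1 <= k < d) (d - k)%:R *:
    (z ^+ k *: (\sum_(j < N) (wb ^+ k) ^+ j *: f j)
     + conjc z ^+ k *: (\sum_(j < N) (w ^+ k) ^+ j *: f j)).
Proof.
transitivity (\sum_(j < N) (d%:R *: f j + \sum_(1 <= k < d) (d - k)%:R *:
    (z ^+ k *: ((wb ^+ k) ^+ j *: f j) + conjc z ^+ k *: ((w ^+ k) ^+ j *: f j)))).
  apply: eq_bigr => j _; rewrite Re_fejer// scalerDl scaler_suml; congr (_ + _).
  apply: eq_bigr => k _; rewrite -scalerA scalerDl; congr (_ *: (_ + _)).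
    by rewrite scalerA exprMn exprAC.
  by rewrite scalerA rmorphM/= rmorphXn/= conjcK exprMn exprAC.
rewrite big_split/= -scaler_sumr; congr (_ + _).
rewrite exchange_big/=; apply: eq_bigr => k _.
by rewrite -scaler_sumr big_split/= -!scaler_sumr.
Qed.

Lemma fejer_sum1 (z : C) :
  \sum_(j < N) complex.Re (fejer d (z * wb ^+ j)) = (N * d)%:R.
Proof.
apply: complexI; rewrite rmorph_sum/= rmorph_nat.
have := fejer_sum (fun=> 1 : C^o) z.
rewrite sumr_const card_ord [X in _ = _ + X]big_nat [X in _ = _ + X]big1 ?addr0; last first.
  move=> k /andP[k0 kd]; have kN : (k < N)%N by exact: ltn_trans dltN.
  have s1 : \sum_(j < N) (wb ^+ k) ^+ j *: (1 : C^o) = 0.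
    have := prim_root_orth wN N0 kN; rewrite eq_sym gtn_eqF// => E.
    rewrite -[RHS]E; apply: eq_bigr => j _.
    by rewrite expr0 mul1r /GRing.scale/= mulr1.
  have s2 : \sum_(j < N) (w ^+ k) ^+ j *: (1 : C^o) = 0.
    have := prim_root_orth wN kN N0; rewrite gtn_eqF// => E.
    rewrite -[RHS]E; apply: eq_bigr => j _.
    by rewrite expr0 mulr1 /GRing.scale/= mulr1.
  by rewrite s1 s2 !scaler0 addr0 scaler0.
rewrite /GRing.scale/= natrM mulrC => <-; apply: eq_bigr => j _.
by rewrite mulr1.
Qed.

Variable n : nat.

(** The discrete Fourier coefficient of frequency [1 - i] of the samples at the points [w ^+ j].
    Index 0 stands for the derivative at the centre, index 1 for the value there, and indices from 2
    on for negative frequencies, which a disc lacks. *)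
Definition moment (f : 'I_N -> 'rV[C]_n) (i : nat) : 'rV[C]_n :=
  N%:R^-1 *: \sum_(j < N) (w ^+ i * wb) ^+ j *: f j.

Lemma moment_cst (x : 'rV[C]_n) i : (i <= d)%N ->
  moment (fun=> x) i = if i == 1%N then x else 0.
Proof.
move=> id_; rewrite /moment -scaler_suml.
have iN : (i < N)%N := leq_ltn_trans id_ dltN.
have N1 : (1 < N)%N := ltn_trans d2 dltN.
have := prim_root_orth wN iN N1; rewrite expr1 => ->.
by case: eqP => _; rewrite ?scale0r ?scaler0// scalerA mulVf// scale1r.
Qed.

Lemma moment_comb (f g : 'I_N -> 'rV[C]_n) (s t : C) i :
  moment (fun j => s *: f j + t *: g j) i = s *: moment f i + t *: moment g i.
Proof.
rewrite /moment !scalerA ![_ * N%:R^-1]mulrC -!scalerA -scalerDr; congr (_ *: _).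
rewrite !scaler_sumr -big_split; apply: eq_bigr => j _ /=.
by rewrite scalerDr !scalerA ![_ * (_ ^+ j)]mulrC.
Qed.

(** Fourier synthesis: samples of the trigonometric polynomial whose coefficient of frequency
    [1 - i] is [e i]. *)
Definition inv_moment (e : nat -> 'rV[C]_n) (j : 'I_N) : 'rV[C]_n :=
  \sum_(i < d.+1) (wb ^+ i * w) ^+ j *: e i.

Lemma inv_momentK e i : (i <= d)%N -> moment (inv_moment e) i = e i.
Proof.
move=> id_; rewrite /moment /inv_moment.
under eq_bigr do rewrite scaler_sumr.
rewrite exchange_big/=.
have E (k : 'I_d.+1) : \sum_(j < N) (w ^+ i * wb) ^+ j *: ((wb ^+ k * w) ^+ j *: e k) =
    (if i == k then N%:R else 0) *: e k.
  have kN : (k < N)%N by apply: leq_ltn_trans dltN; rewrite -ltnS.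
  rewrite -(prim_root_orth wN (leq_ltn_trans id_ dltN) kN) scaler_suml.
  apply: eq_bigr => j _; rewrite scalerA -exprMn; congr (_ ^+ _ *: _).
  by rewrite mulrACA [wb * w]mulrC wwb mulr1.
rewrite (eq_bigr _ (fun k _ => E k)) (bigD1 (Ordinal (id_ : (i < d.+1)%N)))//= eqxx.
rewrite big1 ?addr0 ?scalerA ?mulVf ?scale1r// => k ki.
rewrite ifN ?scale0r//; apply: contra ki => /eqP ik.
by apply/eqP/val_inj.
Qed.

Lemma rvnorm_inv_moment e (eta : R) j : (forall i, (i <= d)%N -> rvnorm (e i) <= eta) ->
  rvnorm (inv_moment e j) <= d.+1%:R * eta.
Proof.
move=> He; rewrite -lecR -rvnormE; apply: le_trans (ler_norm_sum _ _ _) _.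
rewrite (_ : (_)%:C = \sum_(i < d.+1) eta%:C); last first.
  by rewrite sumr_const card_ord mulr_natl rmorphMn.
apply: ler_sum => i _; rewrite normrZ normrX normrc Normc.normcM normcX.
have nw := prim_root_normc wN.
have nwb : normc wb = 1 by apply: complexI; rewrite -normrc normcJ normrc nw.
rewrite nw nwb expr1n mulr1 rmorph1 expr1n mul1r rvnormE lecR; apply: He.
by rewrite -ltnS.
Qed.

(** The Fejer average of the samples at [z] has nonnegative weights of sum 1, so it stays in [Omega]
    throughout the disc. Its coefficient of [conjc z ^+ k] is a multiple of [moment f k.+1], which
    vanishes, so it is a polynomial in [z]; the first harmonic is damped by [(d - 1) / d]. *)
Lemma disc_of_moments (Omega : set 'rV[C]_n) (f : 'I_N -> 'rV[C]_n) :
  convex_set Omega -> (forall j, Omega (f j)) ->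
  (forall i, (2 <= i <= d)%N -> moment f i = 0) ->
  exists F : C -> 'rV[C]_n, [/\ holomorphic_on unit_disc F, F @` unit_disc `<=` Omega,
    F 0 = moment f 1%N & derive1 F 0 = ((d.-1)%:R / d%:R) *: moment f 0%N].
Proof.
move=> cO fO f0.
pose Y k := N%:R^-1 *: \sum_(j < N) (wb ^+ k) ^+ j *: f j.
pose V k := ((d - k)%:R / d%:R) *: Y k.
exists (vpoly d V).
have dE : d = d.-2.+2 by case: d d2 => [|[]].
split.
- by move=> z _; exact: vpoly_differentiable.
- move=> _ [z /unit_discE z1 <-].
  pose t j := complex.Re (fejer d (z * wb ^+ j)) / (N * d)%:R.
  have Nd0 : (0 : R) < (N * d)%:R by rewrite ltr0n muln_gt0 N0.
  have -> : vpoly d V z = \sum_(j < N) (t j)%:C *: f j.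
    have -> : \sum_(j < N) (t j)%:C *: f j = (N * d)%:R^-1 *:
        \sum_(j < N) (complex.Re (fejer d (z * wb ^+ j)))%:C *: f j.
      rewrite scaler_sumr; apply: eq_bigr => j _.
      by rewrite scalerA /t rmorphM/= fmorphV/= rmorph_nat mulrC.
    rewrite fejer_sum /vpoly -(big_mkord xpredT (fun k => z ^+ k *: V k)) (big_ltn d0).
    rewrite expr0 scale1r scalerDr [X in _ = _ + X]scaler_sumr; congr (_ + _).
      rewrite /V subn0 divff// scale1r /Y scalerA natrM invfM -mulrA mulVf// mulr1.
      by congr (_ *: _); apply: eq_bigr => j _; rewrite expr0 expr1n scale1r.
    apply: eq_big_nat => k /andP[k1 kd].
    have -> : \sum_(j < N) (w ^+ k) ^+ j *: f j = 0.
      have := f0 k.+1; rewrite ltnS k1 kd => /(_ isT) mk.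
      have : N%:R *: moment f k.+1 = 0 by rewrite mk scaler0.
      rewrite /moment scalerA divff// scale1r => E; rewrite -[RHS]E; apply: eq_bigr => j _.
      by rewrite exprSr -mulrA wwb mulr1.
    rewrite scaler0 addr0 /V /Y !scalerA; congr (_ *: _).
    by rewrite natrM; field; rewrite NC0 dC0.
  apply: convex_combination => //.
    move=> j; apply: divr_ge0; last exact: ltW.
    apply: fejer_ge0; rewrite Normc.normcM normcX.
    have nw := prim_root_normc wN.
    have -> : normc wb = 1 by apply: complexI; rewrite -normrc normcJ normrc nw.
    by rewrite expr1n mulr1 ltW.
  by rewrite -mulr_suml fejer_sum1 divff// gt_eqF.
- rewrite dE vpoly0 /V subn0 divff// scale1r /Y /moment.
  congr (_ *: _); apply: eq_bigr => j _.
  by rewrite expr1 wwb expr0.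
- rewrite {1}dE vpoly_derive1 /V subn1 /Y /moment expr1.
  by under [in RHS]eq_bigr do rewrite expr0 mul1r.
Qed.
End Moments.

(** * Splitting a bound on all samples into one bound per sample *)

Section SupremumOfSums.
Variables (R : realType) (T : Type) (N : nat).

(** The points [f j] vary independently, so the supremum of the sum is the sum of the suprema. For
    linear [h j], the [u j] are support values of [A]. *)
Lemma sum_sup (h : 'I_N -> T -> R) (A : set T) (rho : R) : A !=set0 ->
  (forall f : 'I_N -> T, (forall j, A (f j)) -> \sum_j h j (f j) <= rho) ->
  exists u : 'I_N -> R, (forall j z, A z -> h j z <= u j) /\ \sum_j u j <= rho.
Proof.
move=> [z0 Az0] H.
have hub j : has_ubound [set h j z | z in A].
  exists (rho - \sum_(k < N | k != j) h k z0) => _ [z Az <-].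
  (* All points but the [j]-th are frozen at [z0]. *)
  have := H (fun k => if k == j then z else z0).
  rewrite (bigD1 j)//= eqxx lerBrDr => /(_ _).
  rewrite (eq_bigr (fun k => h k z0)) => [|k /negbTE ->//].
  by apply => k; case: ifP.
have hs j : has_sup [set h j z | z in A] by split=> //; exists (h j z0); exists z0.
exists (fun j => sup [set h j z | z in A]); split.
  by move=> j z Az; apply: ub_le_sup => //; exists z.
apply/ler_addgt0Pr => e e0.
have e' : 0 < e / (N%:R + 1) by rewrite divr_gt0// ltr_wpDl.
have ex j : exists z, A z /\ sup [set h j z | z in A] <= h j z + e / (N%:R + 1).
  have [_ [z Az <-] hz] := sup_adherent e' (hs j).
  by exists z; split => //; rewrite -lerBlDr ltW.
have [f fP] := choice ex.
apply: (@le_trans _ _ (\sum_j (h j (f j) + e / (N%:R + 1)))).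
  by apply: ler_sum => j _; case: (fP j).
rewrite big_split/= lerD//; first by apply: H => j; case: (fP j).
rewrite sumr_const card_ord -[leLHS]mulr_natl mulrCA -[leRHS]mulr1.
rewrite ler_wpM2l ?(ltW e0)//.
by rewrite ler_pdivrMr ?ltr_wpDl// mul1r lerDl.
Qed.

End SupremumOfSums.

(** * Fejer smoothing of the separating functional *)

Section DualFunction.
Variables (R : realType) (N d n : nat) (w : R[i]).
Local Notation C := R[i].
Local Notation normc := (@Normc.normc R).
Hypotheses (wN : N.-primitive_root w) (d2 : (1 < d)%N) (dN : (2 * d <= N)%N).
Local Notation wb := (conjc w).
Local Notation Re := complex.Re.

Let d0 : (0 < d)%N. Proof. exact: ltnW. Qed.
Let N0 : (0 < N)%N. Proof. exact: prim_order_gt0 wN. Qed.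
Let NC0 : (N%:R : C) != 0. Proof. by rewrite pnatr_eq0 -lt0n. Qed.
Let dC0 : (d%:R : C) != 0. Proof. by rewrite pnatr_eq0 -lt0n. Qed.
Let dltN : (d < N)%N.
Proof. by apply: leq_trans dN; rewrite mul2n -addnn -{1}[d]addn0 ltn_add2l. Qed.
Let N1 : (1 < N)%N. Proof. exact: ltn_trans d2 dltN. Qed.

Lemma Re_sum (I : finType) (F : I -> C) : Re (\sum_i F i) = \sum_i Re (F i).
Proof.
have ReD (x y : C) : Re (x + y) = Re x + Re y by case: x y => [? ?] [? ?].
exact: (big_morph (fun x : C => Re x) ReD).
Qed.

Lemma Re_realM (x : R) (z : C) : Re (x%:C * z) = x * Re z.
Proof. by case: z => a b /=; rewrite mul0r subr0. Qed.

Variable c : nat -> 'I_n -> C.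

(* The separating functional [f |-> sum_i <moment w f i, c i>] evaluates [f]
   at the [N]-th roots of unity against the values [sample_covector j]. *)
Definition sample_covector (j : 'I_N) (l : 'I_n) : C :=
  \sum_(i < d.+1) (w ^+ i * wb) ^+ j * c i l.

Lemma rvdot_dual (z : 'rV[C]_n) j :
  rvdot z (sample_covector j) = \sum_(i < d.+1) (w ^+ i * wb) ^+ j * rvdot z (c i).
Proof.
rewrite /rvdot /sample_covector; under eq_bigr do rewrite mulr_sumr.
rewrite exchange_big/=; apply: eq_bigr => i _; rewrite mulr_sumr.
by apply: eq_bigr => l _; rewrite mulrCA.
Qed.

Lemma sum_dual_moment (f : 'I_N -> 'rV[C]_n) :
  \sum_(i < d.+1) rvdot (moment w f i) (c i) = N%:R^-1 * \sum_j rvdot (f j) (sample_covector j).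
Proof.
under [in RHS]eq_bigr do rewrite rvdot_dual.
rewrite [X in _ = _ * X]exchange_big [RHS]mulr_sumr/=; apply: eq_bigr => i _.
have rZ (k : C) x : rvdot (k *: x) (c i) = k * rvdot x (c i).
  by rewrite /rvdot mulr_sumr; apply: eq_bigr => l _; rewrite mxE mulrA.
have rS (F : 'I_N -> 'rV[C]_n) : rvdot (\sum_j F j) (c i) = \sum_j rvdot (F j) (c i).
  rewrite /rvdot exchange_big/=; apply: eq_bigr => l _.
  by rewrite summxE mulr_suml.
by rewrite /moment rZ rS; congr (_ * _); apply: eq_bigr => j _; rewrite rZ.
Qed.

Lemma sum_dual_pos k l : (k < d)%N ->
  \sum_(j < N) (wb ^+ k) ^+ j * sample_covector j l = N%:R * c k.+1 l.
Proof.
move=> kd; rewrite /sample_covector; under eq_bigr do rewrite mulr_sumr.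
rewrite exchange_big/=.
have E (i : 'I_d.+1) : \sum_(j < N) (wb ^+ k) ^+ j * ((w ^+ i * wb) ^+ j * c i l) =
    (if i == k.+1 :> nat then N%:R else 0) * c i l.
  have iN : (i < N)%N by apply: leq_ltn_trans dltN; rewrite -ltnS.
  have kN : (k.+1 < N)%N by apply: leq_ltn_trans dltN.
  rewrite -(prim_root_orth wN iN kN) mulr_suml; apply: eq_bigr => j _.
  by rewrite mulrA -exprMn; congr (_ ^+ _ * _); rewrite exprSr; ring.
have kd1 : (k.+1 < d.+1)%N by [].
rewrite (eq_bigr _ (fun i _ => E i)) (bigD1 (Ordinal kd1))//= eqxx.
by rewrite big1 ?addr0// => i ik; rewrite ifN ?mul0r.
Qed.

(** Among these frequencies only [c 0], at [k = 1], is present. The sums [k + i] reach [2 d - 1],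
    and [2 * d <= N] keeps them from aliasing. *)
Lemma sum_dual_neg k l : (0 < k < d)%N ->
  \sum_(j < N) (w ^+ k) ^+ j * sample_covector j l = if k == 1%N then N%:R * c 0%N l else 0.
Proof.
move=> /andP[k0 kd]; rewrite /sample_covector; under eq_bigr do rewrite mulr_sumr.
rewrite exchange_big/=.
have E (i : 'I_d.+1) : \sum_(j < N) (w ^+ k) ^+ j * ((w ^+ i * wb) ^+ j * c i l) =
    (if (k + i)%N == 1%N then N%:R else 0) * c i l.
  have kiN : (k + i < N)%N.
    apply: leq_trans dN; rewrite mul2n -addnn -addSn leq_add// -ltnS//.
  rewrite -(prim_root_orth wN kiN N1) mulr_suml; apply: eq_bigr => j _.
  by rewrite mulrA -exprMn; congr (_ ^+ _ * _); rewrite expr1 exprD mulrA.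
rewrite (eq_bigr _ (fun i _ => E i)) big_ord_recl/= addn0 big1 ?addr0.
  by case: eqP => _; rewrite ?mul0r.
by move=> i _; rewrite /= ifN ?mul0r//; case: k k0 {kd E} => // k _; rewrite addSn addnS.
Qed.

(** The weights are the Fejer weights [1 - |i - 1| / d], centred at [i = 1]; as [i.-1] truncates at
    0, the boolean term corrects the case [i = 0]. *)
Definition dual_poly (l : 'I_n) : {poly C} :=
  \poly_(i < d.+1) ((d - i.-1 - (i == 0%N))%:R / d%:R * c i l).

(** The smoothed covectors have lowest frequency -1, and one factor [z] makes them a polynomial. *)
Lemma dual_polyE l (z : C) : normc z = 1 ->
  conjc z * (dual_poly l).[z] =
  (N * d)%:R^-1 * \sum_(j < N) (Re (fejer d (z * wb ^+ j)))%:C * sample_covector j l.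
Proof.
move=> z1.
have zz : conjc z * z = 1.
  have := z1 => /(congr1 (fun x => x ^+ 2)); rewrite normc_sqr.
  case: z {z1} => a b /= h; apply/eqP; rewrite eq_complex/=; apply/andP.
  by split; apply/eqP; [move: h; lra|ring].
have FS := fejer_sum w d2 (fun j => sample_covector j l : C^o) z.
rewrite (_ : \sum_(j < N) _ * _ =
  \sum_(j < N) (Re (fejer d (z * wb ^+ j)))%:C *: (sample_covector j l : C^o))//.
rewrite FS.
have -> : \sum_(j < N) (sample_covector j l : C^o) = N%:R * c 1%N l.
  by rewrite -(sum_dual_pos l d0); apply: eq_bigr => j _; rewrite expr0 expr1n mul1r.
have -> : \sum_(1 <= k < d) (d - k)%:R *:
    (z ^+ k *: (\sum_(j < N) (wb ^+ k) ^+ j *: (sample_covector j l : C^o))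
     + conjc z ^+ k *: (\sum_(j < N) (w ^+ k) ^+ j *: (sample_covector j l : C^o))) =
    \sum_(1 <= k < d) (d - k)%:R * (z ^+ k * (N%:R * c k.+1 l)) +
    (d - 1)%:R * (conjc z * (N%:R * c 0%N l)) :> C.
  transitivity (\sum_(1 <= k < d) ((d - k)%:R * (z ^+ k * (N%:R * c k.+1 l)) +
      (if k == 1%N then (d - 1)%:R * (conjc z * (N%:R * c 0%N l)) else 0))).
    apply: eq_big_nat => k kk; have /andP[_ kd] := kk.
    rewrite -(sum_dual_pos l kd) /GRing.scale/= mulrDr; congr (_ + _).
    rewrite (sum_dual_neg l kk); case: eqP => [->|_]; first by rewrite expr1.
    by rewrite !mulr0.
  rewrite big_split/=; congr (_ + _); rewrite (big_ltn d2)/= big_nat big1 ?addr0//.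
  by move=> k /andP[k2 _]; rewrite gtn_eqF.
rewrite /dual_poly horner_poly.
rewrite -(big_mkord xpredT (fun i => (d - i.-1 - (i == 0%N))%:R / d%:R * c i l * z ^+ i)).
rewrite big_ltn// big_add1/= (big_ltn d0)/= !subn0 expr0 expr1 mulr1.
set S := \sum_(1 <= k < d) _; set S' := \sum_(1 <= k < d) _.
have SE : conjc z * S = (N * d)%:R^-1 * S'.
  rewrite /S /S' !mulr_sumr; apply: eq_bigr => k _; rewrite subn0 exprS.
  transitivity ((conjc z * z) * ((d - k)%:R / d%:R * c k.+1 l * z ^+ k)); first by ring.
  by rewrite zz mul1r natrM; field; rewrite NC0 dC0.
rewrite /GRing.scale/= !mulrDr SE.
rewrite (_ : conjc z * (d%:R / d%:R * c 1%N l * z) = c 1%N l); last first.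
  by transitivity ((conjc z * z) * (d%:R / d%:R * c 1%N l));
    [ring|rewrite zz mul1r divff// mul1r].
by rewrite natrM; field; rewrite NC0 dC0.
Qed.

End DualFunction.

(** * The map into the disc built from the half-spaces *)

Section CaratheodoryCandidate.
Variables (R : realType) (N d n : nat) (w : R[i]).
Local Notation C := R[i].
Local Notation normc := (@Normc.normc R).
Hypotheses (wN : N.-primitive_root w) (d2 : (1 < d)%N) (dN : (2 * d <= N)%N).
Local Notation wb := (conjc w).
Local Notation Re := complex.Re.

Let d0 : (0 < d)%N. Proof. exact: ltnW. Qed.
Let N0 : (0 < N)%N. Proof. exact: prim_order_gt0 wN. Qed.

Lemma sum_rvdot_dual (c : nat -> 'I_n -> C) (z : 'rV[C]_n) :
  \sum_(j < N) rvdot z (sample_covector d w c j) = N%:R * rvdot z (c 1%N).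
Proof.
rewrite /rvdot exchange_big mulr_sumr/=; apply: eq_bigr => l _.
rewrite -mulr_sumr mulrCA -(sum_dual_pos wN d2 dN c l d0); congr (_ * _).
by apply: eq_bigr => j _; rewrite expr0 expr1n mul1r.
Qed.

Lemma fejer0 : fejer d (0 : C) = d%:R.
Proof.
case: d d0 => // d' _; rewrite /fejer big_ord_recl expr0 mulr1 big1 ?addr0// => k _.
by rewrite expr0n/= mulr0.
Qed.

(** The analytic completion of the Fejer average of [b]: its real part on the circle is that
    average. *)
Definition fejer_poly (b : 'I_N -> R) : {poly C} :=
  \poly_(k < d) (fejer_coef R d k * ((N * d)%:R^-1 * \sum_j (b j)%:C * (wb ^+ k) ^+ j)).

Lemma fejer_polyE b z : (fejer_poly b).[z] =
  (N * d)%:R^-1 * \sum_j (b j)%:C * fejer d (z * wb ^+ j).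
Proof.
rewrite /fejer_poly horner_poly /fejer.
under [in RHS]eq_bigr do rewrite mulr_sumr.
rewrite [in RHS]exchange_big [RHS]mulr_sumr/=; apply: eq_bigr => k _.
rewrite [X in X * _]mulrCA -mulrA; congr (_ * _).
rewrite mulrAC mulr_sumr; apply: eq_bigr => j _.
by rewrite exprMn [(wb ^+ j) ^+ k]exprAC; ring.
Qed.

(** The separation bound becomes half-space inequalities for [Omega], one per sample; their Fejer
    average is the hypothesis of [root_function], with [U = fejer_poly b] and [Phi = dual_poly d c].
    Then ['d g a v] is [K1 / m] times [rvdot v (c 0%N)], and [m <= lam * kap / K1]. *)
Lemma dual_function (Omega : set 'rV[C]_n) (a v : 'rV[C]_n) (lam : R)
    (c : nat -> 'I_n -> C) : open Omega -> Omega a -> 0 < lam ->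
  (forall f : 'I_N -> 'rV[C]_n, (forall j, Omega (f j)) ->
    Re (\sum_(i < d.+1) rvdot (moment w f i) (c i))
      < lam * Re (rvdot v (c 0%N)) + Re (rvdot a (c 1%N))) ->
  exists g : 'rV[C]_n -> C,
    [/\ holomorphic_on Omega g, forall z, Omega z -> normc (g z) < 1, g a = 0 &
        (d.-1%:R / d%:R) ^+ 2 / lam <= normc ('d g a v)].
Proof.
move=> oO Oa lam0 sep.
set kap := Re (rvdot v (c 0%N)) in sep.
pose K1 : R := d.-1%:R / d%:R.
have dR : (0 : R) < d%:R by rewrite ltr0n.
have NR : (0 : R) < N%:R by rewrite ltr0n.
have K1_gt0 : 0 < K1 by rewrite divr_gt0// ltr0n -subn1 subn_gt0.
have K1_lt1 : K1 < 1 by rewrite ltr_pdivrMr// mul1r ltr_nat ltn_predL.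
have NC : (N%:R : C) != 0 by rewrite pnatr_eq0 -lt0n.
have natC k : (k%:R : C) = (k%:R : R)%:C by rewrite rmorph_nat.
have lk : 0 < lam * kap.
  have := sep (fun=> a) (fun=> Oa).
  by rewrite sum_dual_moment sum_rvdot_dual mulrA mulVf// mul1r ltrDr.
have kap0 : 0 < kap by rewrite -(pmulr_rgt0 _ lam0).
have [|f fO|u [uP usum]] := @sum_sup R _ N (fun j z => Re (rvdot z (sample_covector d w c j))) Omega
    (N%:R * (lam * kap + Re (rvdot a (c 1%N)))).
- by exists a.
- have /ltW := sep f fO; rewrite sum_dual_moment -(ler_pM2l NR) -Re_realM.
  by rewrite -natC mulrA divff// mul1r Re_sum.
(* The slack makes the inequalities strict; its size is such that
   [lam * kap + eps = lam * kap / K1], which bounds [m]. *)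
pose eps := lam * kap * (K1^-1 - 1).
have eps0 : 0 < eps by rewrite mulr_gt0// subr_gt0 invf_gt1.
(* The bound of the [j]-th half-space, recentred at [a] and widened by [eps]. *)
pose b j := u j + eps - Re (rvdot a (sample_covector d w c j)).
pose m := N%:R^-1 * \sum_j b j.
have bE : \sum_j b j = \sum_j u j + N%:R * eps - N%:R * Re (rvdot a (c 1%N)).
  rewrite /b sumrB big_split/= sumr_const card_ord -[eps *+ N]mulr_natl; congr (_ - _).
  by rewrite -Re_realM -natC -(sum_rvdot_dual c a) Re_sum.
have m_le : m <= lam * kap / K1.
  rewrite /m mulrC ler_pdivrMr// bE.
  have -> : lam * kap / K1 * N%:R = N%:R * (lam * kap) + N%:R * eps.
    by rewrite /eps; ring.
  move: usum; rewrite mulrDr; lra.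
have bz z j : Omega z -> eps <= b j - Re (rvdot (z - a) (sample_covector d w c j)).
  move=> Oz; have := uP j z Oz; rewrite rvdotB /b.
  case: (rvdot z _) => z1 z2; case: (rvdot a _) => a1 a2 /=; lra.
have m0 : 0 < m.
  rewrite mulr_gt0 ?invr_gt0//; apply: lt_le_trans (_ : \sum_(j < N) eps <= _).
    by rewrite sumr_const card_ord -mulr_natl mulr_gt0.
  apply: ler_sum => j _; have := bz a j Oa; rewrite subrr.
  suff -> : rvdot (0 : 'rV[C]_n) (sample_covector d w c j) = 0 by rewrite subr0.
  by rewrite /rvdot big1// => l _; rewrite mxE mul0r.
have Nd0 : (0 : R) < (N * d)%:R by rewrite ltr0n muln_gt0 N0.
have U0E : (fejer_poly b).[0] = m%:C.
  rewrite fejer_polyE.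
  under eq_bigr do rewrite mul0r fejer0.
  have dC : (d%:R : C) != 0 by rewrite pnatr_eq0 -lt0n.
  transitivity (N%:R^-1 * \sum_(j < N) (b j)%:C : C).
    by rewrite -mulr_suml natrM; field; rewrite NC dC.
  by rewrite /m rmorphM/= fmorphV/= rmorph_nat rmorph_sum.
have [|U0 [g [dg g1 ga gd]]] := @root_function R n Omega a (fejer_poly b)
    (dual_poly d c) oO Oa.
  move=> z Oz zeta z1.
  have zz : zeta * conjc zeta = 1.
    have := z1 => /(congr1 (fun x => x ^+ 2)); rewrite normc_sqr.
    case: zeta {z1} => x y /= h; apply/eqP; rewrite eq_complex/=; apply/andP.
    by split; apply/eqP; [move: h; lra|ring].
  (* On the circle the real part of the right-hand side is a combination of the half-space
     inequalities with nonnegative Fejer weights. *)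
  have -> : (zeta * (fejer_poly b).[zeta] - rvdot (z - a) (fun l => (dual_poly d c l).[zeta]))
      * conjc zeta = (((N * d)%:R : R)^-1)%:C *
      \sum_(j < N) ((b j)%:C * fejer d (zeta * wb ^+ j) -
        (Re (fejer d (zeta * wb ^+ j)))%:C * rvdot (z - a) (sample_covector d w c j)).
    rewrite mulrBl mulrAC zz mul1r sumrB mulrBr fejer_polyE fmorphV/= rmorph_nat.
    congr (_ - _); rewrite /rvdot mulr_suml.
    under [in RHS]eq_bigr do rewrite mulr_sumr.
    rewrite exchange_big mulr_sumr/=; apply: eq_bigr => l _.
    rewrite -mulrA [_ * conjc zeta]mulrC (dual_polyE wN d2 dN c l z1).
    rewrite mulrCA; congr (_ * _); rewrite mulr_sumr; apply: eq_bigr => j _.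
    by rewrite mulrCA.
  rewrite Re_realM Re_sum mulr_gt0 ?invr_gt0//.
  apply: lt_le_trans (_ : \sum_(j < N) Re (fejer d (zeta * wb ^+ j)) * eps <= _).
    by rewrite -mulr_suml (fejer_sum1 wN d2 dN) mulr_gt0.
  apply: ler_sum => j _.
  have F0 : 0 <= Re (fejer d (zeta * wb ^+ j)).
    apply: fejer_ge0; rewrite Normc.normcM normcX z1 mul1r.
    have nw := prim_root_normc wN.
    have -> : normc wb = 1 by apply: complexI; rewrite -normrc normcJ normrc nw.
    by rewrite expr1n.
  have := ler_wpM2l F0 (bz z j Oz).
  move: (rvdot _ _) (fejer _ _) => [x1 x2] [y1 y2] /=; lra.
exists g; split => //.
have -> : 'd g a v = (K1 / m)%:C * rvdot v (c 0%N).
  have E : rvdot v (fun l => (dual_poly d c l).[0]) = K1%:C * rvdot v (c 0%N).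
    rewrite /rvdot [RHS]mulr_sumr; apply: eq_bigr => l _.
    rewrite horner_coef0 coef_poly /= subn0 subn1 /K1 rmorphM/= fmorphV/= !rmorph_nat.
    by rewrite mulrCA.
  have KE (x y : R) : (x / y)%:C = x%:C / y%:C by rewrite rmorphM/= fmorphV.
  by apply: (etrans (gd v)); rewrite U0E E (KE K1 m) mulrAC.
rewrite Normc.normcM normc_real ger0_norm; last by rewrite divr_ge0// ltW.
apply: (@le_trans _ _ (K1 / m * kap)); last first.
  rewrite ler_wpM2l//; first by rewrite divr_ge0// ltW.
  exact: le_trans (ler_norm _) (Re_le_normc _).
rewrite -/K1 ler_pdivrMr//.
have -> : K1 / m * kap * lam = (K1 * (lam * kap)) / m by ring.
rewrite ler_pdivlMr// expr2 -mulrA ler_wpM2l ?(ltW K1_gt0)//.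
by rewrite mulrC -ler_pdivlMr.
Qed.

End CaratheodoryCandidate.

(** * Equality of the metrics *)

Section Kobayashi.
Variables (R : realType) (n : nat).
Local Notation C := R[i].
Local Notation normc := (@Normc.normc R).
Local Notation Re := complex.Re.
Local Notation Im := complex.Im.

Lemma rvnorm_le (h : 'rV[C]_n) (e : R) : 0 < e ->
  (forall l, normc (h ord0 l) < e) -> rvnorm h < e.
Proof.
move=> e0 he; have : ball (0 : 'rV[C]_n) e%:C h.
  split; first by rewrite ltcR.
  by move=> i l; rewrite -ball_normE/= mxE sub0r normrN normrc ltcR ord1.
by rewrite -ball_normE/= sub0r normrN rvnormE ltcR.
Qed.

Lemma rvnormZ (k : C) (h : 'rV[C]_n) : rvnorm (k *: h) = normc k * rvnorm h.
Proof. by apply: complexI; rewrite rmorphM/= -!rvnormE -normrc normrZ. Qed.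

Lemma rvdotZ (k : C) (h : 'rV[C]_n) c : rvdot (k *: h) c = k * rvdot h c.
Proof. by rewrite /rvdot mulr_sumr; apply: eq_bigr => l _; rewrite mxE mulrA. Qed.

Lemma open_rvnorm (Omega : set 'rV[C]_n) a : open Omega -> Omega a ->
  exists2 e : R, 0 < e & forall h, rvnorm h < e -> Omega (a + h).
Proof.
rewrite openE => oO /oO /nbhs_ballP[e e0 H].
have eE : e = (Re e)%:C by rewrite RRe_real// gtr0_real.
exists (Re e); first by rewrite -ltcR -eE.
move=> h he; apply: H; rewrite -ball_normE/= opprD addrA subrr add0r normrN.
by rewrite rvnormE eE ltcR.
Qed.

Section Coordinates.
Variable d : nat.

Definition coords (Y : nat -> 'rV[C]_n) (p : 'I_d.+1 * 'I_n * bool) : R :=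
  if p.2 then Re (Y p.1.1 ord0 p.1.2) else Im (Y p.1.1 ord0 p.1.2).

(** The minus sign makes the real pairing of coordinates the real part of the bilinear pairing
    [rvdot]. *)
Definition covector (psi : 'I_d.+1 * 'I_n * bool -> R) (i : nat) (l : 'I_n) : C :=
  psi (inord i, l, true) +i* - psi (inord i, l, false).

Lemma sum_coords psi Y : \sum_p psi p * coords Y p =
  Re (\sum_(i < d.+1) rvdot (Y i) (covector psi i)).
Proof.
rewrite Re_sum.
transitivity (\sum_(q : 'I_d.+1 * 'I_n) \sum_b psi (q, b) * coords Y (q, b)).
  by rewrite pair_bigA/=; apply: eq_bigr => -[q b].
transitivity (\sum_(i < d.+1) \sum_(l < n) \sum_b psi (i, l, b) * coords Y (i, l, b)).
  by rewrite [RHS]pair_bigA/=; apply: eq_bigr => -[i l].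
apply: eq_bigr => i _; rewrite /rvdot Re_sum; apply: eq_bigr => l _.
rewrite big_bool /coords /covector /= inord_val.
by case: (Y i ord0 l) => x y /=; ring.
Qed.

End Coordinates.

(** The moments of the affine disc with centre [a] and derivative [lam v]. *)
Definition target (a v : 'rV[C]_n) (lam : R) (i : nat) : 'rV[C]_n :=
  if i == 0%N then lam%:C *: v else if i == 1%N then a else 0.

(* If the target moments are nearly attained in [Omega], shrinking towards the
   interior point [a] makes room to correct the error, at the cost of a factor. *)
Lemma moments_far (d N : nat) (w : C) (Omega : set 'rV[C]_n) (a v : 'rV[C]_n) (lam : R) :
  N.-primitive_root w -> (1 < d)%N -> (2 * d <= N)%N ->
  open Omega -> convex_set Omega -> Omega a ->
  let K1 : R := d.-1%:R / d%:R in
  (forall F : C -> 'rV[C]_n, holomorphic_on unit_disc F ->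
    F @` unit_disc `<=` Omega -> F 0 = a -> derive1 F 0 = (K1 ^+ 2 * lam)%:C *: v -> False) ->
  exists2 e : R, 0 < e & forall f : 'I_N -> 'rV[C]_n, (forall j, Omega (f j)) ->
    e <= \sum_(p : 'I_d.+1 * 'I_n * bool)
           (coords (moment w f) p - coords (target a v lam) p) ^+ 2.
Proof.
move=> wN d2 dN oO cO Oa K1 noF.
set T := target a v lam.
have d0 : (0 < d)%N by exact: ltnW.
have dR : (0 : R) < d%:R by rewrite ltr0n.
have K1_gt0 : 0 < K1 by rewrite divr_gt0// ltr0n -subn1 subn_gt0.
have K1_lt1 : K1 < 1 by rewrite ltr_pdivrMr// mul1r ltr_nat ltn_predL.
have K1' : 0 < 1 - K1 by rewrite subr_gt0.
have K1n : 1 - K1 != 0 by rewrite gt_eqF.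
have [rho rho0 Orho] := open_rvnorm oO Oa.
(* The correction [h] has [d.+1] terms of size [eta], so its norm is at most [rho * (1 - K1)];
   scaled by [K1 / (1 - K1)] it stays below [rho]. *)
pose eta := rho * (1 - K1) / d.+1%:R.
have dS : (0 : R) < d.+1%:R by rewrite ltr0n.
have eta0 : 0 < eta by rewrite divr_gt0// mulr_gt0.
exists ((eta / 2) ^+ 2); first by rewrite exprn_gt0// divr_gt0.
move=> f fO; rewrite leNgt; apply/negP => small.
pose e i := T i - moment w f i.
have e_small i : (i <= d)%N -> rvnorm (e i) <= eta.
  move=> id_; apply/ltW/rvnorm_le => // l.
  have coord b : `|coords (moment w f) (inord i : 'I_d.+1, l, b)
                   - coords T (inord i : 'I_d.+1, l, b)| < eta / 2.
    set x := coords _ _ - _.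
    suff : x ^+ 2 < (eta / 2) ^+ 2.
      by rewrite -(real_normK (num_real x)) ltr_sqr// nnegrE divr_ge0// ltW.
    apply: le_lt_trans small; rewrite (bigD1 (inord i : 'I_d.+1, l, b))//= lerDl.
    by apply: sumr_ge0 => p _; rewrite sqr_ge0.
  move: (coord true) (coord false); rewrite /coords/= inordK//.
  have -> : e i ord0 l = T i ord0 l - moment w f i ord0 l.
    by rewrite /e mxE; congr (_ + _); rewrite mxE.
  case: (T i ord0 l) => t1 t2; case: (moment w f i ord0 l) => m1 m2 c1 c2.
  apply: le_lt_trans (normc_le_ReIm _) _; move: c1 c2 => /= c1 c2.
  by rewrite [eta]splitr [`|t1 - _|]distrC [`|t2 - _|]distrC ltrD.
pose h : 'I_N -> 'rV[C]_n := inv_moment d w e.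
(* The weights turn [h] into [K1] times the error [e], so the moments become exactly [K1 * T], plus
   [(1 - K1) * a] at index 1. The centre is again [a], and only the derivative shrinks. *)
pose f' j := K1%:C *: f j + (1 - K1)%:C *: (a + (K1 / (1 - K1))%:C *: h j).
have f'O j : Omega (f' j).
  move/convex_setCP: cO; apply.
  - exact: fO.
  - apply: Orho; rewrite rvnormZ normc_real ger0_norm; last by rewrite divr_ge0// ltW.
    have := rvnorm_inv_moment wN j e_small.
    rewrite /eta mulrC divfK ?gt_eqF// => hj.
    rewrite mulrAC ltr_pdivrMr//; apply: le_lt_trans (_ : K1 * (rho * (1 - K1)) < _).
      by rewrite ler_wpM2l// ltW.
    by rewrite gtr_pMl// mulr_gt0.
  - by rewrite !ltW.
have mf' i : (i <= d)%N -> moment w f' i =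
    K1%:C *: T i + (1 - K1)%:C *: (if i == 1%N then a else 0).
  move=> id_; rewrite /f' moment_comb.
  have -> : moment w (fun j => a + (K1 / (1 - K1))%:C *: h j) i =
      (if i == 1%N then a else 0) + (K1 / (1 - K1))%:C *: e i.
    have := moment_comb w (fun=> a) h 1 (K1 / (1 - K1))%:C i.
    by rewrite !scale1r (moment_cst wN d2 dN)// (inv_momentK wN d2 dN)// => <-.
  have KE : (1 - K1)%:C * (K1 / (1 - K1))%:C = K1%:C.
    by rewrite -rmorphM/= mulrC divfK.
  by rewrite scalerDr scalerA KE /e scalerBr addrCA subrKC addrC.
have mf0 i : (2 <= i <= d)%N -> moment w f' i = 0.
  move=> /andP[i2 id_]; rewrite mf'// /T /target; case: i i2 id_ => [|[|i]]//= _ _.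
  by rewrite !scaler0 addr0.
have [F [hF FO F0 F'0]] := disc_of_moments wN d2 dN cO f'O mf0.
apply: (noF F) => //.
  by rewrite F0 mf'//= -scalerDl -rmorphD/= subrKC scale1r.
rewrite F'0 mf'//= scaler0 addr0 !scalerA; congr (_ *: _).
have -> : (d.-1%:R / d%:R : C) = K1%:C.
  by rewrite /K1 rmorphM/= fmorphV/= !rmorph_nat.
by rewrite -!rmorphM/= expr2 mulrA.
Qed.

End Kobayashi.

Section Lempert.
Variables (R : realType) (n : nat).
Local Notation C := R[i].
Local Notation normc := (@Normc.normc R).
Local Notation Re := complex.Re.

Lemma ereal_two_between (x y : \bar R) : (0 <= x)%E -> (x < y)%E ->
  exists r s : R, [/\ 0 < r, r < s, (x < r%:E)%E & (s%:E < y)%E].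
Proof.
case: x => [x| |] //; last by move=> _; rewrite ltNge leey.
rewrite lee_fin => x0; case: y => [y| |] //.
  rewrite lte_fin => xy; exists ((2 * x + y) / 3), ((x + 2 * y) / 3).
  by rewrite !lte_fin; split; lra.
by move=> _; exists (x + 1), (x + 2); rewrite lte_fin ltry; split => //; lra.
Qed.

(** The total loss of the construction is the fourth power of [(d - 1) / d]. *)
Lemma fejer_ratio_ge (r s : R) : 0 < r -> r < s ->
  exists2 d, (1 < d)%N & r <= (d.-1%:R / d%:R) ^+ 4 * s.
Proof.
move=> r0 rs; have s0 := lt_trans r0 rs.
have sr : 0 < s - r by rewrite subr_gt0.
pose k := Num.bound (4 * s / (s - r)).
have hk : 4 * s / (s - r) < k%:R by apply: archi_boundP; rewrite divr_ge0 ?mulr_ge0// ltW.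
exists k.+2 => //=.
pose x : R := k.+2%:R^-1.
have k2 : (0 : R) < k.+2%:R by rewrite ltr0n.
have -> : k.+1%:R / k.+2%:R = 1 - x :> R.
  by rewrite -[k.+1%:R](addrK 1) natr1 mulrBl divff ?gt_eqF// mul1r.
have x0 : 0 < x by rewrite invr_gt0.
have xs : 4 * s * x <= s - r.
  rewrite ler_pdivrMr// -ler_pdivrMl// [_^-1 * _]mulrC.
  apply/ltW; apply: (lt_le_trans hk).
  by rewrite ler_nat -addn2 leq_addr.
(* This is [s] times the remainder in [(1 - x) ^+ 4 >= 1 - 4 * x]. *)
have : 0 <= x ^+ 2 * ((x - 2) ^+ 2 + 2) * s.
  by rewrite !mulr_ge0 ?sqr_ge0 ?addr_ge0 ?sqr_ge0// ltW.
nra.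
Qed.

Lemma caratheodory_ge0 (Omega : set 'rV[C]_n) a v : (0 <= caratheodory Omega a v)%E.
Proof.
apply: ereal_sup_ubound; exists (cst 0).
  split; first by move=> z _; exact: differentiable_cst.
  by move=> _ [z _ <-]; exact: unit_disc0.
have -> : 'd (cst 0 : 'rV[C]_n -> C) a v = 0.
  exact: (congr1 (fun f : 'rV[C]_n -> C => f v) (@diff_cst C 'rV[C]_n C 0 a)).
by rewrite /poincare Normc.normc0 mul0r.
Qed.

(** Two reals [r < s] are placed strictly between the metrics. As [s] is below the Kobayashi metric,
    no disc has derivative [s^-1 v]; duality then yields a Caratheodory competitor of size at least
    [K1 ^+ 4 * s], and the gap from [r] to [s] absorbs the loss. *)
Lemma kobayashi_le_caratheodory (Omega : set 'rV[C]_n) (a v : 'rV[C]_n) :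
  open Omega -> convex_set Omega -> Omega a ->
  (kobayashi Omega a v <= caratheodory Omega a v)%E.
Proof.
move=> oO cO Oa; rewrite leNgt; apply/negP => CK.
have [r [s [r0 rs Cr sK]]] := ereal_two_between (caratheodory_ge0 Omega a v) CK.
have s0 := lt_trans r0 rs.
have [d d2 rd] := fejer_ratio_ge r0 rs.
pose K1 : R := d.-1%:R / d%:R.
have dR : (0 : R) < d%:R by rewrite ltr0n ltnW.
have K1_gt0 : 0 < K1 by rewrite divr_gt0// ltr0n -subn1 subn_gt0.
(* Chosen so that the disc excluded in [moments_far], of derivative [K1 ^+ 2 * lam] times [v], is
   the one of derivative [s^-1 v]. *)
pose lam := s^-1 / K1 ^+ 2.
have lam0 : 0 < lam by rewrite divr_gt0 ?invr_gt0 ?exprn_gt0.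
have KlE : K1 ^+ 2 * lam = s^-1 by rewrite /lam mulrC divfK// expf_neq0// gt_eqF.
have dd0 : (0 < 2 * d)%N by rewrite muln_gt0 /= (ltnW d2).
have [w wN] := prim_root_exists R dd0.
have dN := leqnn (2 * d).
have noF (F : C -> 'rV[C]_n) : holomorphic_on unit_disc F ->
    F @` unit_disc `<=` Omega -> F 0 = a ->
    derive1 F 0 = (K1 ^+ 2 * lam)%:C *: v -> False.
  move=> hF FO F0; rewrite KlE => F'0; move: sK; apply/negP; rewrite -leNgt.
  apply: ereal_inf_lbound; exists s^-1; last by rewrite div1r invrK.
  by split; [rewrite invr_gt0|exists F].
have [e e0 far] := moments_far wN d2 dN oO cO Oa noF.
pose M : set ('I_d.+1 * 'I_n * bool -> R) :=
  [set x | exists2 f : 'I_(2 * d) -> 'rV[C]_n, forall j, Omega (f j) &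
     x = coords (moment w f)].
have M0 : M !=set0.
  pose fa : 'I_(2 * d) -> 'rV[C]_n := fun=> a.
  by exists (coords (moment w fa)); exists fa.
have cM x y t : M x -> M y -> 0 <= t <= 1 -> M (fun p => t * x p + (1 - t) * y p).
  move=> [f fO ->] [g gO ->] t01.
  exists (fun j => t%:C *: f j + (1 - t)%:C *: g j).
    by move=> j; move/convex_setCP: cO; apply.
  apply/funext => p; rewrite /coords moment_comb.
  move: (moment w f _) (moment w g _) => y1 y2.
  have -> : (t%:C *: y1 + (1 - t)%:C *: y2) ord0 p.1.2 =
      t%:C * y1 ord0 p.1.2 + (1 - t)%:C * y2 ord0 p.1.2 by rewrite !mxE.
  case: (y1 _ _) => a1 b1; case: (y2 _ _) => a2 b2.
  by case: p.2 => /=; ring.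
have farM x : M x -> e <= \sum_p (x p - coords (target a v lam) p) ^+ 2.
  by move=> [f fO ->]; exact: far.
have [psi psiP] := strict_separation M0 cM e0 farM.
have sep (f : 'I_(2 * d) -> 'rV[C]_n) : (forall j, Omega (f j)) ->
    Re (\sum_(i < d.+1) rvdot (moment w f i) (covector psi i))
      < lam * Re (rvdot v (covector psi 0%N)) + Re (rvdot a (covector psi 1%N)).
  move=> fO; have := psiP _ (ex_intro2 _ _ f fO erefl); rewrite !sum_coords.
  congr (_ < _); rewrite Re_sum.
  have dE : d.+1 = d.-1.+2 by rewrite prednK// ltnW.
  rewrite -(big_mkord xpredT
    (fun i => Re (rvdot (target a v lam i) (covector psi i)))) dE big_mkord.
  rewrite big_ord_recl big_ord_recl big1 ?addr0.
    by rewrite /target /= rvdotZ Re_realM.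
  move=> i _; rewrite /target /= (_ : rvdot 0 _ = 0)//.
  by rewrite /rvdot big1// => l _; rewrite mxE mul0r.
have [g [hg g1 ga dg]] := dual_function wN d2 dN oO Oa lam0 sep.
have : (r%:E <= caratheodory Omega a v)%E.
  have : (caratheodory Omega a v >= (poincare (g a) ('d g a v))%:E)%E.
    apply: ereal_sup_ubound; exists g => //; split => //.
    by move=> _ [z Oz <-]; apply/unit_discE/g1.
  apply: le_trans; rewrite lee_fin /poincare ga Normc.normc0 expr0n/= subr0 divr1.
  apply: le_trans dg; apply: (le_trans rd).
  have -> : (d.-1%:R / d%:R) ^+ 2 / lam = (K1 ^+ 4 * s) :> R.
    by rewrite /lam -/K1; field; rewrite !gt_eqF.
  by [].
by rewrite leNgt Cr.
Qed.

End Lempert.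

Theorem theorem12 (R : realType) (n : nat) (Omega : set 'rV[R[i]]_n)
    (Omega_domain : is_domain Omega) (Omega_convex : convex_set Omega)
    (a : 'rV[R[i]]_n) (a_Omega : Omega a) (v : 'rV[R[i]]_n) :
  caratheodory Omega a v = kobayashi Omega a v.
Proof.
case: Omega_domain => oO _ _; apply/eqP; rewrite eq_le.
rewrite caratheodory_le_kobayashi//.
exact: kobayashi_le_caratheodory.
Qed.
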